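(* Let $\mathfrak g$ be one of the DG Lie algebras $\mathcal T_{poly}^{\cdot}[1](M)$ or $\mathcal D_{poly}^{\cdot}[1](M)$ of a smooth manifold $M$, let $\pi\in\mathfrak g$ be a Maurer-Cartan element, and let $\mathscr X=\{X_n\}_{n\ge 1}$ be an $L_\infty$-derivation of $\mathfrak g$ which verifies the strong Nijenhuis condition with respect to $\pi$. Then for any $f,g\in\mathfrak g^{-1}$ such that $d_\pi f=0=d_\pi g$, and all $k,l=0,1,2,\dots$, the elements $\mathscr X_{\pi,1}^k(f)$ and $\mathscr X_{\pi,1}^l(g)$ commute with respect to $\pi$: $$\{\mathscr X_{\pi,1}^k(f),\mathscr X_{\pi,1}^l(g)\}=[\mathscr X_{\pi,1}^k(f),[\pi,\mathscr X_{\pi,1}^l(g)]]=0.$$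
   Context: The ground field has characteristic $0$ ($\mathbb R$ or $\mathbb C$). All infinite series below are assumed to converge in $\mathfrak g$ (for instance because one works with coefficients extended to formal power series in $\hbar$ and $\pi$ is divisible by $\hbar$). The two DG Lie algebras. $\mathcal T_{poly}^{\cdot}[1](M)$ is the graded Lie algebra of polyvector fields on $M$ with the Schouten bracket and zero differential, where $p$-vector fields have degree $p-1$. $\mathcal D_{poly}^{\cdot}[1](M)$ is the DG Lie algebra of local Hochschild cochains (polydifferential operators) of $C^\infty(M)$, with the Hochschild differential and the Gerstenhaber bracket, where $p$-cochains have degree $p-1$. In both cases the lowest degree is $-1$, the degree $-1$ part $\mathfrak g^{-1}$ consists of the functions on $M$, the differential $d$ vanishes on $\mathfrak g^{-1}$, and $[\mathfrak g^{-1},\mathfrak g^{-1}]=0$. A Maurer-Cartan element is $\pi\in\mathfrak g$ of degree $1$ with $d\pi+\frac12[\pi,\pi]=0$. Put $d_\pi(a)=da+[\pi,a]$. For $f,g\in\mathfrak g^{-1}$ put $\{f,g\}=[f,[\pi,g]]=[f,d_\pi g]$ (for $\mathcal T_{poly}$ this is the Poisson bracket of the bivector $\pi$; for $\mathcal D_{poly}$ it is the commutator $f\star g-g\star f$ of the deformed product determined by $\pi$). $L_\infty$-derivations. Let $\Lambda_{\mathfrak g}=\Lambda^*(\mathfrak g[1])$ be the free graded cocommutative coalgebra with the codifferential $D$ whose Taylor coefficients are $D_1=d$, $D_2=[\,,]$, $D_n=0$ for $n\ge3$. An $L_\infty$-derivation of $\mathfrak g$ is a degree $0$ linear map $\mathscr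 X:\Lambda_{\mathfrak g}\to\Lambda_{\mathfrak g}$ which is a coderivation of the free coalgebra and commutes with $D$. It is determined by its Taylor coefficients $X_n:\wedge^n\mathfrak g\to\mathfrak g$, $n\ge1$, of degree $1-n$; commutation with $D$ means that, with signs given by the Koszul rule, $$dX_{n+1}(a_0,\dots,a_n)=\sum_{0\le i<j\le n}\pm X_n([a_i,a_j],a_0,\dots,\widehat{a}_i,\dots,\widehat{a}_j,\dots,a_n)+\sum_{i=0}^n\pm[a_i,X_n(a_0,\dots,\widehat a_i,\dots,a_n)],$$ where $dX_{n+1}$ on the left denotes the differential of the map $X_{n+1}$ (its graded commutator with $d$), and $X_1$ commutes with $d$. Put $\mathscr X(\pi)=\sum_{n\ge1}\frac1{n!}X_n(\pi,\dots,\pi)$ and, for $n\ge1$, $$\mathscr X_{\pi,n}(a_1,\dots,a_n)=\sum_{p\ge0}\frac{1}{p!}X_{n+p}(a_1,\dots,a_n,\underbrace{\pi,\dots,\pi}_{p}).$$ $\mathscr X_{\pi,1}^k$ is the $k$-fold composition of $\mathscr X_{\pi,1}:\mathfrak g\to\mathfrak g$. $\mathscr X$ verifies the strong Nijenhuis condition with respect to $\pi$ if, for all $n\ge 1$, $\mathscr X_{\pi,n}(a_1,\dots,a_n)=0$ whenever $a_i=\mathscr X(\pi)$ for some $i\in\{1,\dots,n\}$. *)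

(* Defs.v *)
From HB Require Import structures.
From mathcomp Require Import all_boot all_order all_algebra.
From mathcomp Require Import complex.
From mathcomp Require Import all_classical all_reals all_analysis.

Set Implicit Arguments.
Unset Strict Implicit.
Unset Printing Implicit Defensive.

Import Order.TTheory GRing.Theory Num.Theory.
Import numFieldNormedType.Exports.

Local Open Scope classical_set_scope.
Local Open Scope ring_scope.

Variant ground := RealGround | ComplexGround.

Definition ground_field (R : realType) (k : ground) : numFieldType :=
  match k with RealGround => R | ComplexGround => R[i] end.

Definition re_part (R : realType) (k : ground) : ground_field R k -> R :=
  match k with RealGround => id | ComplexGround => @complex.Re R end.

Definition im_part (R : realType) (k : ground) : ground_field R k -> R :=
  match k with RealGround => fun=> 0 | ComplexGround => @complex.Im R end.

Definition of_parts (R : realType) (k : ground) : R -> R -> ground_field R k :=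
  match k with
  | RealGround => fun x _ => x
  | ComplexGround => fun x y => (x +i* y)%C
  end.

(* C^r on an open set V : all iterated partial derivatives of order at most r
   exist and are continuous at the points of V. *)
Fixpoint Cr (R : realType) (n r : nat) (V : set 'rV[R]_n) (f : 'rV[R]_n -> R)
    : Prop :=
  (forall x, V x -> {for x, continuous f}) /\
  match r with
  | 0 => True
  | r'.+1 => forall i : 'I_n,
      (forall x, V x -> derivable f x (delta_mx 0 i)) /\
      Cr r' V (fun x => 'D_(delta_mx 0 i) f x)
  end.

Definition Cinfty (R : realType) (n : nat) (V : set 'rV[R]_n)
  (f : 'rV[R]_n -> R) : Prop := forall r, Cr r V f.

(* Outside dom (resp. outside the image of dom) the values of to_euc (resp. of
   of_euc) are irrelevant. *)
Record chart (R : realType) (M : topologicalType) (n : nat) := Chart {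
  dom : set M;
  to_euc : M -> 'rV[R]_n;
  of_euc : 'rV[R]_n -> M }.

Record is_chart (R : realType) (M : topologicalType) (n : nat)
    (c : chart R M n) : Prop := IsChart {
  chart_open_dom : open (dom c);
  chart_open_im : open (to_euc c @` dom c);
  chart_cancel : forall x, dom c x -> of_euc c (to_euc c x) = x;
  chart_continuous : forall x, dom c x -> {for x, continuous (to_euc c)};
  chart_inv_continuous : forall v, (to_euc c @` dom c) v ->
    {for v, continuous (of_euc c)} }.

Record manifold (R : realType) := Manifold {
  points :> topologicalType;
  dim : nat;
  atlas : set (chart R points dim);
  manifold_hausdorff : hausdorff_space points;
  manifold_second_countable : @second_countable points;
  atlas_chart : forall c, atlas c -> is_chart c;
  atlas_cover : forall x : points, exists2 c, atlas c & dom c x;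
  atlas_compatible : forall c c', atlas c -> atlas c' -> forall i : 'I_dim,
    Cinfty (to_euc c @` (dom c `&` dom c'))
           (fun v => to_euc c' (of_euc c v) 0 i) }.

Definition smooth_on (R : realType) (k : ground) (M : manifold R) (V : set M)
    (f : M -> (ground_field R k)^o) : Prop :=
  forall c, atlas c ->
  Cinfty (to_euc c @` (dom c `&` V)) (fun v => re_part (f (of_euc c v))) /\
  Cinfty (to_euc c @` (dom c `&` V)) (fun v => im_part (f (of_euc c v))).

Section SmoothClosed.
Variables (R : realType) (n : nat) (V : set 'rV[R]_n).
Hypothesis oV : open V.

Lemma Cr_congr r f g : {in V, f =1 g} -> Cr r V f -> Cr r V g.
Proof.
move=> fg Hf.
have nfg (f1 g1 : _ -> R) x : {in V, f1 =1 g1} -> V x -> {near x, f1 =1 g1}.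
  move=> fg1 Vx; near=> y; apply/fg1/mem_set; near: y.
  exact: open_nbhs_nbhs.
elim: r f g fg Hf => [|r IHr] f g fg [cf df].
all: have cg : forall x, V x -> {for x, continuous g}
  by move=> x Vx; rewrite /prop_for /continuous_at -(fg x (mem_set Vx));
    exact: cvg_trans (near_eq_cvg (nfg _ _ _ fg Vx)) (cf x Vx).
  by [].
split=> // i; have [dif Cdf] := df i; split.
  by move=> x Vx; apply: near_eq_derivable (dif x Vx); exact: nfg.
apply: IHr Cdf => x /set_mem Vx.
by apply: near_eq_derive; exact: nfg.
Unshelve. all: by end_near. Qed.

Lemma CrS r f : Cr r.+1 V f -> Cr r V f.
Proof.
elim: r f => [|r IHr] f [cf df]; first by split.
by split=> // i; have [dif Cdf] := df i; split=> //; exact: IHr.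
Qed.

Lemma Cr_cst r (a : R) : Cr r V (fun=> a).
Proof.
have ca (b : R) x : V x -> {for x, continuous (fun=> b : R)}.
  by move=> _; exact: cst_continuous.
elim: r a => [|r IHr] a; first by split=> //; exact: ca.
split=> [|i]; first exact: ca.
split=> [x _|]; first exact: derivable_cst.
by apply: Cr_congr (IHr 0) => x _; rewrite derive_cst.
Qed.

Lemma CrD r f g : Cr r V f -> Cr r V g -> Cr r V (fun x => f x + g x).
Proof.
have cfg (f1 g1 : _ -> R) : (forall x, V x -> {for x, continuous f1}) ->
    (forall x, V x -> {for x, continuous g1}) ->
    forall x, V x -> {for x, continuous (fun x => f1 x + g1 x)}.
  by move=> cf cg x Vx; exact: (cvgD (cf x Vx) (cg x Vx)).
elim: r f g => [|r IHr] f g [cf df] [cg dg]; split => //; try exact: cfg.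
move=> i; have [dif Cf] := df i; have [dig Cg] := dg i; split=> [x Vx|].
  by apply: derivableD; [exact: dif|exact: dig].
apply: Cr_congr (IHr _ _ Cf Cg) => x /set_mem Vx.
by rewrite [RHS](deriveD (dif x Vx) (dig x Vx)).
Qed.

Lemma CrM r f g : Cr r V f -> Cr r V g -> Cr r V (fun x => f x * g x).
Proof.
have cfg (f1 g1 : _ -> R) : (forall x, V x -> {for x, continuous f1}) ->
    (forall x, V x -> {for x, continuous g1}) ->
    forall x, V x -> {for x, continuous (fun x => f1 x * g1 x)}.
  by move=> cf cg x Vx; exact: (cvgM (cf x Vx) (cg x Vx)).
elim: r f g => [|r IHr] f g Hf Hg; have [cf df] := Hf; have [cg dg] := Hg;
  split=> //; try exact: cfg.
move=> i; have [dif Cf] := df i; have [dig Cg] := dg i; split=> [x Vx|].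
  by apply: derivableM; [exact: dif|exact: dig].
apply: Cr_congr (CrD (IHr _ _ (CrS Hf) Cg) (IHr _ _ (CrS Hg) Cf)).
move=> x /set_mem Vx; rewrite [RHS](deriveM (dif x Vx) (dig x Vx)).
by rewrite /GRing.scale/= [g x * _]mulrC.
Qed.

End SmoothClosed.

Section SmoothFunctions.
Variables (R : realType) (k : ground) (M : manifold R).
Local Notation K := (ground_field R k).

Lemma re_partD (a b : K) : re_part (a + b) = re_part a + re_part b.
Proof. by case: k a b => // -[? ?] [? ?]. Qed.

Lemma im_partD (a b : K) : im_part (a + b) = im_part a + im_part b.
Proof. by case: k a b => [a b|[? ?] [? ?]//]; rewrite /= addr0. Qed.

Lemma re_partM (a b : K) :
  re_part (a * b) = re_part a * re_part b + -1 * (im_part a * im_part b).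
Proof.
by case: k a b => [a b|[? ?] [? ?]]; rewrite /= mulN1r// mulr0 oppr0 addr0.
Qed.

Lemma im_partM (a b : K) :
  im_part (a * b) = re_part a * im_part b + im_part a * re_part b.
Proof. by case: k a b => [a b|[? ?] [? ?]//]; rewrite /= mulr0 mul0r addr0. Qed.

Definition smooth_pred : {pred M -> K^o} := fun f => `[< smooth_on setT f >].

Let open_im (c : chart R M (dim M)) : atlas c ->
  open (to_euc c @` (dom c `&` setT)).
Proof. by move=> /atlas_chart Hc; rewrite setIT; exact: chart_open_im. Qed.

Lemma smooth_cst (a : K) : smooth_on setT (fun _ : M => a : K^o).
Proof. by move=> c /open_im oc; split=> r; exact: Cr_cst. Qed.

Lemma smoothD (f g : M -> K^o) : smooth_on setT f -> smooth_on setT g ->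
  smooth_on setT (f + g).
Proof.
move=> Hf Hg c Hc; have oc := open_im Hc.
have [Rf If] := Hf c Hc; have [Rg Ig] := Hg c Hc; split=> r.
  apply: Cr_congr (CrD oc (Rf r) (Rg r)) => // x _; exact/esym/re_partD.
by apply: Cr_congr (CrD oc (If r) (Ig r)) => // x _; exact/esym/im_partD.
Qed.

Lemma smoothM (f g : M -> K^o) : smooth_on setT f -> smooth_on setT g ->
  smooth_on setT (f * g).
Proof.
move=> Hf Hg c Hc; have oc := open_im Hc.
have [Rf If] := Hf c Hc; have [Rg Ig] := Hg c Hc; split=> r.
  apply: (@Cr_congr _ _ _ oc _ _ _ _ (CrD oc (CrM oc (Rf r) (Rg r))
    (CrM oc (Cr_cst oc r (-1)) (CrM oc (If r) (Ig r))))) => x _.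
  exact/esym/re_partM.
apply: (@Cr_congr _ _ _ oc _ _ _ _ (CrD oc (CrM oc (Rf r) (Ig r))
  (CrM oc (If r) (Rg r)))) => x _.
exact/esym/im_partM.
Qed.

Lemma smooth_subring_closed : subring_closed smooth_pred.
Proof.
split=> [|f g|f g]; rewrite !unfold_in.
- by apply/asboolP; exact: (smooth_cst 1).
- move=> /asboolP Hf /asboolP Hg; apply/asboolP.
  have -> : f - g = f + (cst (-1) : M -> K^o) * g.
    by apply/funext => x; rewrite !fctE mulN1r.
  by apply: smoothD => //; apply: smoothM => //; exact: smooth_cst.
- by move=> /asboolP Hf /asboolP Hg; apply/asboolP; exact: smoothM.
Qed.

HB.instance Definition _ :=
  GRing.isSubringClosed.Build (M -> K^o) smooth_pred smooth_subring_closed.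

Lemma smooth_scaler_closed : GRing.scaler_closed smooth_pred.
Proof.
move=> a f; rewrite !unfold_in => /asboolP Hf; apply/asboolP.
by have := smoothM (smooth_cst a) Hf.
Qed.

HB.instance Definition _ :=
  GRing.isScaleClosed.Build K (M -> K^o) smooth_pred smooth_scaler_closed.

Record smooth_function : Type := SmoothFunction {
  smooth_fun :> M -> K^o;
  smooth_funP : smooth_fun \in smooth_pred }.

HB.instance Definition _ := [isSub for smooth_fun].
HB.instance Definition _ := [Choice of smooth_function by <:].
HB.instance Definition _ :=
  GRing.SubChoice_isSubComPzRing.Build (M -> K^o) smooth_pred smooth_function
    (subringClosedP _).
HB.instance Definition _ :=
  [SubZmodule_isSubLmodule of smooth_function by <:].

End SmoothFunctions.

(* An internally graded vector space with an operation of degree 1 and a binary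
   operation of degree 0: dg_comp g p is the subspace g^p of the ambient space,
   and only elements of these subspaces are elements of the Lie algebra. *)
Record dg_data (K : numFieldType) := DgData {
  dg_space :> lmodType K;
  dg_comp : int -> set dg_space;
  dg_diff : dg_space -> dg_space;
  dg_brak : dg_space -> dg_space -> dg_space }.

Section PolyLie.
Variables (R : realType) (k : ground) (M : manifold R).
Local Notation K := (ground_field R k).
Local Notation A := (smooth_function k M).

Definition partial (i : 'I_(dim M)) (h : 'rV[R]_(dim M) -> K)
    (v : 'rV[R]_(dim M)) : K :=
  of_parts k ('D_(delta_mx 0 i) (fun w => re_part (h w)) v)
             ('D_(delta_mx 0 i) (fun w => im_part (h w)) v).

Definition partials (I : seq 'I_(dim M)) (h : 'rV[R]_(dim M) -> K) :=
  foldr partial h I.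

(* A cochain is a function of a list of arguments; its restriction to the lists
   of length m is an m-ary operation on C^oo(M). *)
Definition cochain := seq A -> A.

(* Near every point of every chart, c is on lists of length m a finite sum
   c (f_1, ..., f_m) = \sum_t a_t (d^{J_t1} f_1) ... (d^{J_tm} f_m) with smooth
   coefficients a_t, all multi-indices satisfying adm.  A multi-index is given
   as a list of coordinate indices.  In particular c is multilinear. *)
Definition polydifferential (adm : pred (seq 'I_(dim M))) (c : cochain) : Prop :=
  forall (m : nat) (ch : chart R M (dim M)) (x : M), atlas ch -> dom ch x ->
  exists (V : set M) (N : nat) (a : 'I_N -> M -> K^o)
         (J : 'I_N -> 'I_m -> seq 'I_(dim M)),
    [/\ [/\ open V, V x & V `<=` dom ch],
        (forall t, smooth_on V (a t)),
        (forall t j, adm (J t j)) &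
        forall s : seq A, size s = m -> forall y, V y ->
          c s y = \sum_(t < N) a t y *
            \prod_(j < m) partials (J t j)
              (fun v => nth 0 s j (of_euc ch v)) (to_euc ch y) ].

(* p + 1 arguments in degree p *)
Definition has_degree (p : int) (c : cochain) : Prop :=
  forall s, (size s)%:Z != p + 1 -> c s = 0.

Definition alternating (c : cochain) : Prop :=
  forall s f g t, c (s ++ f :: g :: t) = - c (s ++ g :: f :: t).

(* The bracket c o e - (-1)^{|c||e|} e o c, where c o e is the alternating sum
   of the insertions of e into an argument of c.  Inhomogeneous cochains are
   treated component by component: in the summand where the block of l arguments
   following the first i ones goes to the inner cochain, the latter has degree
   l - 1 and the outer one has degree size s - l. *)
Definition gerstenhaber (c e : cochain) : cochain := fun s =>
  \sum_(i < (size s).+1) \sum_(l < (size s - i).+1)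
    (-1) ^+ (i * l.+1) *
    (let put u w := u (take i s ++ w (take l (drop i s)) :: drop (i + l) s) in
     put c e - (-1) ^+ (l.+1 * (size s - l)) * put e c).

Definition multiplication : cochain := fun s =>
  if s is [:: f; g] then f * g else 0.

(* The Hochschild differential, with the sign for which pi is Maurer-Cartan if
   and only if the product (multiplication + pi) is associative. *)
Definition hochschild (c : cochain) : cochain := gerstenhaber multiplication c.

Definition Dpoly : dg_data K := {|
  dg_space := cochain;
  dg_comp := fun p c => has_degree p c /\ polydifferential predT c;
  dg_diff := hochschild;
  dg_brak := gerstenhaber |}.

(* Parity of the shuffle moving the positions selected by m to the front. *)
Definition shuffle_inv (n : nat) (m : n.-tuple bool) : nat :=
  \sum_(j < n) \sum_(i < n | (i < j)%N) (~~ tnth m i && tnth m j).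

(* With polyvector fields viewed as alternating operators on functions, the
   bracket P o Q - (-1)^{|P||Q|} Q o P, where (P o Q)(f_1, ..., f_n) is the sum
   over shuffles of +- P (Q (f_i, i in S), f_j, j not in S). *)
Definition schouten (P Q : cochain) : cochain := fun s =>
  \sum_(m : (size s).-tuple bool)
    (-1) ^+ shuffle_inv m *
    (let l := count id m in
     let put u w := u (w (mask m s) :: mask (map negb m) s) in
     put P Q - (-1) ^+ (l.+1 * (size s - l)) * put Q P).

(* A p-vector field \sum P^{i_1...i_p} d_{i_1} /\ ... /\ d_{i_p} is identified
   with the operator (f_1, ..., f_p) |-> <P, df_1 /\ ... /\ df_p>, i.e. with an
   alternating operator which is locally \sum P^{i_1...i_p} d_{i_1}f_1 ...
   d_{i_p}f_p. *)
Definition Tpoly : dg_data K := {|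
  dg_space := cochain;
  dg_comp := fun p c => [/\ has_degree p c, alternating c &
    polydifferential [pred I : seq 'I_(dim M) | size I == 1%N] c];
  dg_diff := fun _ => 0;
  dg_brak := schouten |}.

End PolyLie.

(* Extension of the coefficients to formal power series in hbar: a n is the
   coefficient of hbar^n. *)
Definition formal (K : numFieldType) (g : dg_data K) : dg_data K := {|
  dg_space := nat -> g;
  dg_comp := fun p a => forall n, dg_comp p (a n);
  dg_diff := fun a n => dg_diff (a n);
  dg_brak := fun a b n => \sum_(i < n.+1) dg_brak (a i) (b (n - i)%N) |}.

Section Linfinity.
Variables (K : numFieldType) (g : dg_data K).

Definition maurer_cartan (pi : g) : Prop :=
  dg_comp 1 pi /\ dg_diff pi + 2^-1 *: dg_brak pi pi = 0.

Definition twisted_diff (pi a : g) : g := dg_diff a + dg_brak pi a.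

Definition pi_bracket (pi f h : g) : g := dg_brak f (dg_brak pi h).

(* Lists of homogeneous elements of g, each recorded with its degree in g (one
   more than its degree in g[1]). *)
Definition homogeneous (s : seq (int * g)) : Prop :=
  forall x, x \in s -> dg_comp x.1 x.2.

Definition total_degree (s : seq (int * g)) : int := \sum_(x <- s) x.1.

Definition shifted (x : int * g) : int := x.1 - 1.

Definition delete (i : nat) (s : seq (int * g)) := take i s ++ drop i.+1 s.

(* Koszul sign, for the degrees in g[1], of moving the i-th element of s to the
   front. *)
Definition front_sign (i : nat) (s : seq (int * g)) : K :=
  (-1) ^ (shifted (nth (0, 0) s i) * \sum_(x <- take i s) shifted x).

(* The bracket as a graded symmetric operation of degree 1 on g[1]. *)
Definition shifted_brak (x y : int * g) : g :=
  (-1) ^ shifted x *: dg_brak x.2 y.2.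

(* X is the family of Taylor coefficients of an L_oo-derivation: X_n is the
   restriction of X to the lists of length n (and X_0 = 0).  A map from the n-th
   exterior power of g to g of degree 1 - n is, as usual, viewed as a graded
   symmetric map of degree 0 on g[1].  Linf_commute is the component of
   D o X = X o D on the input s. *)
Record Linf_derivation (X : seq g -> g) : Prop := LinfDerivation {
  Linf_nil : X [::] = 0;
  Linf_degree : forall s, homogeneous s -> s != [::] ->
    dg_comp (total_degree s + 1 - (size s)%:Z) (X (unzip2 s));
  Linf_linear : forall s t p a b (c : K), homogeneous s -> homogeneous t ->
    dg_comp p a -> dg_comp p b ->
    X (unzip2 s ++ (c *: a + b) :: unzip2 t) =
    c *: X (unzip2 s ++ a :: unzip2 t) + X (unzip2 s ++ b :: unzip2 t);
  Linf_symmetric : forall s t x y, homogeneous s -> homogeneous t ->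
    dg_comp x.1 x.2 -> dg_comp y.1 y.2 ->
    X (unzip2 s ++ x.2 :: y.2 :: unzip2 t) =
    (-1) ^ (shifted x * shifted y) *: X (unzip2 s ++ y.2 :: x.2 :: unzip2 t);
  Linf_commute : forall s, homogeneous s -> s != [::] ->
    let a i := nth (0, 0) s i in
    let deg t := total_degree t + 1 - (size t)%:Z in
    dg_diff (X (unzip2 s)) +
    \sum_(i < size s) front_sign i s *:
      shifted_brak (a i) (deg (delete i s), X (unzip2 (delete i s))) =
    \sum_(i < size s) front_sign i s *:
      X (dg_diff (a i).2 :: unzip2 (delete i s)) +
    \sum_(j < size s) \sum_(i < size s | (i < j)%N)
      (front_sign i s * front_sign j.-1 (delete i s)) *:
      X (shifted_brak (a i) (a j) :: unzip2 (delete j.-1 (delete i s))) }.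

(* A notion of convergence of sequences in g (for instance that of a Hausdorff
   topology, or the hbar-adic one) for which limits may be computed as usual:
   the linear operations, d and the bracket are continuous. *)
Record admissible_convergence (to : (nat -> g) -> g -> Prop) : Prop :=
  AdmissibleConvergence {
  conv_unique : forall u p q a b, dg_comp p a -> dg_comp q b ->
    to u a -> to u b -> a = b;
  conv_cst : forall p a, dg_comp p a -> to (fun=> a) a;
  conv_shift : forall u p a, (forall n, dg_comp p (u n)) -> dg_comp p a ->
    to (fun n => u n.+1) a <-> to u a;
  conv_linear : forall u v p a b (c : K),
    (forall n, dg_comp p (u n)) -> (forall n, dg_comp p (v n)) ->
    dg_comp p a -> dg_comp p b -> to u a -> to v b ->
    to (fun n => c *: u n + v n) (c *: a + b);
  conv_diff : forall u p a, (forall n, dg_comp p (u n)) -> dg_comp p a ->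
    to u a -> to (fun n => dg_diff (u n)) (dg_diff a);
  conv_brak : forall u p q a b, dg_comp p b -> (forall n, dg_comp q (u n)) ->
    dg_comp q a -> to u a -> to (fun n => dg_brak b (u n)) (dg_brak b a) }.

Variable to : (nat -> g) -> g -> Prop.

Definition is_sum (p : int) (u : nat -> g) (a : g) : Prop :=
  dg_comp p a /\ to (fun N => \sum_(n < N) u n) a.

Definition sum_of (u : nat -> g) : g := xget 0 [set a | exists p, is_sum p u a].

Variables (X : seq g -> g) (pi : g).

(* The n = 0 term of X(pi) vanishes, as X_0 = 0. *)
Definition value_term (n : nat) : g := (n`!%:R)^-1 *: X (nseq n pi).

Definition value : g := sum_of value_term.

Definition twisted_term (s : seq g) (p : nat) : g :=
  (p`!%:R)^-1 *: X (s ++ nseq p pi).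

(* twisted s is X_{pi,n} (a_1, ..., a_n) for s = [:: a_1; ...; a_n]. *)
Definition twisted (s : seq g) : g := sum_of (twisted_term s).

Definition all_series_converge : Prop :=
  (exists a, is_sum 1 value_term a) /\
  forall s, homogeneous s -> s != [::] ->
    exists a, is_sum (total_degree s + 1 - (size s)%:Z)
                     (twisted_term (unzip2 s)) a.

Definition strong_nijenhuis : Prop :=
  forall s, homogeneous s -> value \in unzip2 s -> twisted (unzip2 s) = 0.

End Linfinity.

(* Main.v *)
Require Import Defs.
From mathcomp Require Import all_boot all_order all_algebra.
From mathcomp Require Import all_classical all_reals all_analysis.
From mathcomp Require Import ring zify.
Import Defs.

                                                                          
                                                                          
                                                                             
                                                                           
                                                                              
                                
                                                                           
                                                                              
                                                                             
                                              

                                                                             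
                                                                       
                                                              
                                                                    
                                                                              
                                                                           
                                                                           
                                                                             
                                                                            
                                         

                                                                   
                                                                          
                                                                             
                                                                           
                                                                            
                                                                              
                                                                         
                                                                            
                                                                      
                                                       

Set Implicit Arguments.
Unset Strict Implicit.
Unset Printing Implicit Defensive.

Import Order.TTheory GRing.Theory Num.Theory.
Local Open Scope ring_scope.


                                          

                                                                              
                                                                              
                                                                              
                                                     
Record low_degree_calculus (K : numFieldType) (g : dg_data K) : Prop := {
  comp_linear : forall p (c : K) (a b : g),
    dg_comp p a -> dg_comp p b -> dg_comp p (c *: a + b);
  comp0 : forall p, dg_comp p (0 : g);
  brak_linear : forall p q (c : K) (e a b : g),
    dg_comp p e -> dg_comp q a -> dg_comp q b ->
    dg_brak e (c *: a + b) = c *: dg_brak e a + dg_brak e b;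
  diff_linear : forall p (c : K) (a b : g), dg_comp p a -> dg_comp p b ->
    dg_diff (c *: a + b) = c *: dg_diff a + dg_diff b;
  diff_function : forall f : g, dg_comp (- 1) f -> dg_diff f = 0;
  diff_degree1 : forall P : g, dg_comp 1 P -> dg_comp 2 (dg_diff P);
  brak_function_comp : forall f P : g,
    dg_comp (- 1) f -> dg_comp 1 P -> dg_comp 0 (dg_brak f P);
  brak_comp : forall P Q : g,
    dg_comp 1 P -> dg_comp 1 Q -> dg_comp 2 (dg_brak P Q);
  brak_functionC : forall f P : g,
    dg_comp (- 1) f -> dg_comp 1 P -> dg_brak P f = dg_brak f P;
  brakC : forall P Q : g,
    dg_comp 1 P -> dg_comp 1 Q -> dg_brak P Q = dg_brak Q P;
  brak_anti : forall f h P : g,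
    dg_comp (- 1) f -> dg_comp (- 1) h -> dg_comp 1 P ->
    dg_brak f (dg_brak P h) = - dg_brak h (dg_brak P f) }.

Section WeightedSums.
Variables (K : numFieldType) (V : lmodType K).

                                                                          
                                                                            
                                                                              
                                                                           
Lemma sum_fact1 (G : nat -> V) N :
  \sum_(p < N.+1) (p`!%:R)^-1 *: (G p.-1 *+ p) =
  \sum_(p < N) (p`!%:R)^-1 *: G p.
Proof.
rewrite big_ord_recl mulr0n scaler0 add0r; apply: eq_bigr => p _ /=.
by rewrite /bump /= add1n factS natrM invfM -scaler_nat scalerA mulrAC mulVf
  ?mul1r ?pnatr_eq0//.
Qed.

Lemma sum_fact2 (G : nat -> V) N :
  \sum_(p < N.+2) (p`!%:R)^-1 *: (G p.-2 *+ 'C(p, 2)) =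
  2^-1 *: \sum_(p < N) (p`!%:R)^-1 *: G p.
Proof.
rewrite 2!big_ord_recl/= !bin_small// !mulr0n !scaler0 !add0r scaler_sumr.
apply: eq_bigr => p _ /=; rewrite /bump /= !add1n /= -scaler_nat !scalerA.
congr (_ *: _).
have /(congr1 (fun n => n%:R : K)) := bin_fact (isT : (2 <= p.+2)%N).
rewrite subSS subSS subn0 !natrM => <-.
have b0 : ('C(p.+2, 2)%:R : K) != 0 by rewrite pnatr_eq0 -lt0n bin_gt0.
by rewrite !invfM mulrAC mulVf// mul1r.
Qed.

End WeightedSums.

Section Derivation.
Variables (K : numFieldType) (g : dg_data K).
Hypothesis hg : low_degree_calculus g.
Variables (pi : g) (X : seq g -> g).
Hypotheses (hpi : maurer_cartan pi) (hX : Linf_derivation X).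

Implicit Types (s : seq (int * g)) (u : seq g).

Lemma comp_scale p (c : K) (a : g) : dg_comp p a -> dg_comp p (c *: a).
Proof.
by move=> ha; rewrite -[_ *: _]addr0; apply: comp_linear => //; exact: comp0.
Qed.

Lemma comp_add p (a b : g) : dg_comp p a -> dg_comp p b -> dg_comp p (a + b).
Proof. by move=> ha hb; rewrite -[a]scale1r; exact: comp_linear. Qed.

Lemma comp_sum p N (a : nat -> g) : (forall n, dg_comp p (a n)) ->
  dg_comp p (\sum_(n < N) a n).
Proof.
move=> ha; elim: N => [|N IH]; first by rewrite big_ord0; exact: comp0.
by rewrite big_ord_recr; exact: comp_add.
Qed.

Section LinearOn.
Variables (W : lmodType K) (p : int) (L : g -> W).
Hypothesis L_linear : forall (c : K) a b, dg_comp p a -> dg_comp p b ->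
  L (c *: a + b) = c *: L a + L b.

Lemma linear_on0 : L 0 = 0.
Proof.
have := L_linear 1 (comp0 hg p) (comp0 hg p); rewrite !scale1r addr0.
by move/eqP; rewrite -subr_eq subrr eq_sym => /eqP.
Qed.

Lemma linear_onZ c a : dg_comp p a -> L (c *: a) = c *: L a.
Proof.
by move=> ha; rewrite -[c *: a]addr0 L_linear ?linear_on0 ?addr0//;
  exact: comp0.
Qed.

Lemma linear_onD a b : dg_comp p a -> dg_comp p b -> L (a + b) = L a + L b.
Proof. by move=> ha hb; rewrite -[a]scale1r L_linear ?scale1r. Qed.

Lemma linear_on_sum N (c : nat -> K) (a : nat -> g) :
  (forall n, dg_comp p (a n)) ->
  L (\sum_(n < N) c n *: a n) = \sum_(n < N) c n *: L (a n).
Proof.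
move=> ha; elim: N => [|N IH]; first by rewrite !big_ord0 linear_on0.
rewrite !big_ord_recr /= linear_onD ?linear_onZ ?IH//; last exact: comp_scale.
by apply: (@comp_sum p N (fun n => c n *: a n)) => n; exact: comp_scale.
Qed.
End LinearOn.

Lemma homogeneous_cons x s : homogeneous (x :: s) <->
  dg_comp x.1 x.2 /\ homogeneous s.
Proof.
split=> [h|[hx h] y]; last by rewrite inE => /orP[/eqP->//|/h].
by split=> [|y ys]; apply: h; rewrite ?mem_head// inE ys orbT.
Qed.

Lemma homogeneous_cat s t : homogeneous (s ++ t) <->
  homogeneous s /\ homogeneous t.
Proof.
split=> [h|[hs ht] y]; last by rewrite mem_cat => /orP[/hs|/ht].
by split=> y ys; apply: h; rewrite mem_cat ys ?orbT.
Qed.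

Lemma homogeneous_nil : homogeneous ([::] : seq (int * g)). Proof. by []. Qed.

Lemma homogeneous_pi p : homogeneous (nseq p (1, pi)).
Proof. by move=> x /nseqP[-> _]; exact: hpi.1. Qed.

Lemma homogeneous_delete i s : homogeneous s -> homogeneous (delete i s).
Proof.
by move=> h x; rewrite mem_cat => /orP[/mem_take|/mem_drop]; exact: h.
Qed.

Definition series_degree s : int := total_degree s + 1 - (size s)%:Z.

Lemma unzip2_pi s p : unzip2 s ++ nseq p pi = unzip2 (s ++ nseq p (1, pi)).
Proof. by rewrite /unzip2 map_cat map_nseq. Qed.

Lemma X_pi_comp s p : homogeneous s ->
  dg_comp (series_degree s) (X (unzip2 s ++ nseq p pi)).
Proof.
move=> hs; rewrite unzip2_pi.
have [/eqP|s0] := eqVneq (s ++ nseq p (1, pi)) [::].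
  by move=> /eqP ->; rewrite /= (Linf_nil hX); exact: comp0.
have -> : series_degree s = series_degree (s ++ nseq p (1, pi)).
  rewrite /series_degree /total_degree big_cat /= size_cat size_nseq big_nseq.
  have -> : iter p (+%R 1) 0 = p%:Z by rewrite -[RHS]natz; elim: p {s0} => //=
    p ->; rewrite -natr1 addrC.
  by rewrite PoszD; ring.
by apply: (Linf_degree hX) => //; apply/homogeneous_cat; split=> //;
  exact: homogeneous_pi.
Qed.

Definition del (i : nat) u := take i u ++ drop i.+1 u.

Lemma unzip2_delete i s : unzip2 (delete i s) = del i (unzip2 s).
Proof. by rewrite /unzip2 map_cat map_take map_drop. Qed.

                                                                              
                                     
Definition odd_degrees s := forall x, x \in s -> x.1 = - 1 \/ x.1 = 1.

Lemma odd_degrees_pi s p : odd_degrees s -> odd_degrees (s ++ nseq p (1, pi)).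
Proof.
by move=> os x; rewrite mem_cat => /orP[/os//|/nseqP[-> _]]; right.
Qed.

Lemma even_sign (x : int * g) (n : int) : x.1 = - 1 \/ x.1 = 1 ->
  (-1 : K) ^ (shifted x * n) = 1.
Proof.
rewrite /shifted -exprz_exp => -[] ->.
  rewrite (_ : (-1) ^ (-1 - 1) = 1) ?exp1rz//.
  by rewrite -opprD -invr_expz -exprnP sqrrN expr1n invr1.
by rewrite subrr expr0z exp1rz.
Qed.

Lemma pred_lt_delete i j n :
  (j < n)%N -> (i < n)%N -> (i < j)%N -> (j - 1 < i + (n - i.+1))%N.
Proof. lia. Qed.

Lemma commute_odd s : homogeneous s -> odd_degrees s -> s != [::] ->
  let u := unzip2 s in let n := size s in
  dg_diff (X u) + \sum_(i < n) dg_brak (nth 0 u i) (X (del i u)) =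
  \sum_(i < n) X (dg_diff (nth 0 u i) :: del i u) +
  \sum_(j < n) \sum_(i < j)
    X (dg_brak (nth 0 u i) (nth 0 u j) :: del j.-1 (del i u)).
Proof.
move=> hs os s0 u n.
have os' i : (i < n)%N -> odd_degrees [:: nth (0, 0) s i].
  by move=> ? x; rewrite inE => /eqP ->; apply/os/mem_nth.
have shift1 i : (i < n)%N -> (-1 : K) ^ shifted (nth (0, 0) s i) = 1.
  by move=> ?; rewrite -[shifted _]mulr1 even_sign//; exact/os/mem_nth.
have sign1 i : (i < n)%N -> front_sign i s = 1.
  by move=> ?; rewrite /front_sign even_sign//; exact/os/mem_nth.
have nth2 i : (i < n)%N -> (nth (0, 0) s i).2 = nth 0 u i.
  by move=> ?; rewrite (nth_map (0, 0)).
have := Linf_commute hX hs s0; rewrite /=.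
under eq_bigr => i _ do
  rewrite sign1// scale1r /shifted_brak shift1// scale1r nth2// /=
    unzip2_delete.
under [X in _ = X + _ -> _]eq_bigr => i _ do
  rewrite sign1// scale1r nth2// unzip2_delete.
under [X in _ = _ + X -> _]eq_bigr => j _.
  under eq_bigr => i ij.
    rewrite sign1// mul1r.
    have -> : front_sign j.-1 (delete i s) = 1.
      apply: even_sign; apply: os.
      have : nth (0, 0) (delete i s) j.-1 \in delete i s.
        apply: mem_nth; rewrite size_cat size_take size_drop.
        have js : (j < size s)%N := ltn_ord j.
        have is' : (i < size s)%N := ltn_ord i.
        by rewrite is' -subn1; exact: pred_lt_delete.
      by rewrite mem_cat => /orP[/mem_take|/mem_drop].
    rewrite scale1r /shifted_brak shift1// scale1r !nth2// !unzip2_delete.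
    over.
  rewrite -(big_ord_widen _ (fun i => X (dg_brak (nth 0 u i) (nth 0 u j) ::
     del j.-1 (del i u)))) 1?ltnW//.
  over.
by [].
Qed.

Section WithPi.
Variables (u : seq g) (p : nat).
Local Notation n := (size u).
Local Notation w := (u ++ nseq p pi).

Lemma nth_pi_l i : (i < n)%N -> nth 0 w i = nth 0 u i.
Proof. by move=> ?; rewrite nth_cat ifT. Qed.

Lemma nth_pi_r i : (i < p)%N -> nth 0 w (n + i) = pi.
Proof.
by move=> ip; rewrite nth_cat ltnNge leq_addr /= addKn nth_nseq ip.
Qed.

Lemma del_pi_l i : (i < n)%N -> del i w = del i u ++ nseq p pi.
Proof.
move=> i_n; rewrite /del take_cat i_n drop_cat -catA; congr (_ ++ _).
case: ltngtP => // [|->]; first by rewrite ltnNge i_n.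
by rewrite subnn drop0 drop_size.
Qed.

Lemma del_pi_r i : (i < p)%N -> del (n + i) w = u ++ nseq p.-1 pi.
Proof.
move=> ip; rewrite /del take_cat ltnNge leq_addr /=
  drop_cat ltnNge leqW ?leq_addr//=.
rewrite -catA; congr (_ ++ _);
  rewrite -addnS !addKn take_nseq ?drop_nseq 1?ltnW//.
by rewrite -nseqD; congr nseq; lia.
Qed.
End WithPi.

Lemma size_del i u : (i < size u)%N -> size (del i u) = (size u).-1.
Proof.
by move=> iu; rewrite size_cat size_take size_drop iu; move: (size u) iu => m;
  lia.
Qed.

                                                                        
                                                                     
Lemma commute_pi s p : homogeneous s -> odd_degrees s ->
  let u := unzip2 s in let n := size u in
  dg_diff (X (u ++ nseq p pi)) +
    (\sum_(i < n) dg_brak (nth 0 u i) (X (del i u ++ nseq p pi)) +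
     dg_brak pi (X (u ++ nseq p.-1 pi)) *+ p) =
  \sum_(i < n) X (dg_diff (nth 0 u i) :: del i u ++ nseq p pi) +
  X (dg_diff pi :: u ++ nseq p.-1 pi) *+ p +
  (\sum_(j < n) \sum_(i < j)
     X (dg_brak (nth 0 u i) (nth 0 u j) :: del j.-1 (del i u) ++ nseq p pi) +
   (\sum_(i < n) X (dg_brak (nth 0 u i) pi :: del i u ++ nseq p.-1 pi) *+ p +
    X (dg_brak pi pi :: u ++ nseq p.-2 pi) *+ 'C(p, 2))).
Proof.
move=> hs os u n.
                                                           
have [sp0|sp0] := eqVneq (s ++ nseq p (1, pi)) [::].
  have [s0 p0] : s = [::] /\ p = 0%N by case: (s) (p) sp0 => [|? ?] [|?].
  rewrite /n /u s0 p0 /= (Linf_nil hX) !big_ord0 !mulr0n !addr0.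
  exact: linear_on0 (diff_linear hg (p := 1)).
have hsp : homogeneous (s ++ nseq p (1, pi)).
  by apply/homogeneous_cat; split => //; exact: homogeneous_pi.
have sE : size (s ++ nseq p (1, pi)) = (n + p)%N.
  by rewrite size_cat size_nseq /n size_map.
have := commute_odd hsp (odd_degrees_pi (p := p) os) sp0.
rewrite /= -unzip2_pi -/u {hsp sp0}sE => E.
have split_sum (F : nat -> g) (C : g) : (forall i, (i < p)%N ->
      F (n + i)%N = C) ->
    \sum_(i < n + p) F i = \sum_(i < n) F i + C *+ p.
  move=> FC; rewrite big_split_ord /=; congr (_ + _).
  by rewrite -[in RHS](card_ord p) -sumr_const; apply: eq_bigr => i _;
    exact: FC.
have E1 : \sum_(i < n + p) dg_brak (nth 0 (u ++ nseq p pi) i)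
      (X (del i (u ++ nseq p pi))) =
    \sum_(i < n) dg_brak (nth 0 u i) (X (del i u ++ nseq p pi)) +
     dg_brak pi (X (u ++ nseq p.-1 pi)) *+ p.
  etransitivity.
    by apply: (split_sum (fun i =>
      dg_brak (nth 0 (u ++ nseq p pi) i) (X (del i (u ++ nseq p pi))))) => i ip;
      rewrite nth_pi_r// del_pi_r.
  by congr (_ + _); apply: eq_bigr => i _; rewrite nth_pi_l// del_pi_l.
have E2 : \sum_(i < n + p) X (dg_diff (nth 0 (u ++ nseq p pi) i) ::
      del i (u ++ nseq p pi)) =
    \sum_(i < n) X (dg_diff (nth 0 u i) :: del i u ++ nseq p pi) +
    X (dg_diff pi :: u ++ nseq p.-1 pi) *+ p.
  etransitivity.
    by apply: (split_sum (fun i =>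
      X (dg_diff (nth 0 (u ++ nseq p pi) i) :: del i (u ++ nseq p pi)))) =>
      i ip; rewrite nth_pi_r// del_pi_r.
  by congr (_ + _); apply: eq_bigr => i _; rewrite nth_pi_l// del_pi_l.
rewrite {}E1 {}E2 in E; rewrite {}E; congr (_ + _).
rewrite big_split_ord /=; congr (_ + _).
  apply: eq_bigr => j _; apply: eq_bigr => i _.
  have i_n : (i < n)%N by exact: ltn_trans (ltn_ord i) (ltn_ord j).
  rewrite !nth_pi_l// del_pi_l// del_pi_l// size_del//.
  by move: (ltn_ord i) (ltn_ord j); rewrite -/n; lia.
under eq_bigr => j _.
  rewrite nth_pi_r// big_split_ord /=.
  under eq_bigr => i _.
    rewrite nth_pi_l// del_pi_l//.
    have -> : (n + j).-1 = (size (del i u) + j)%N by rewrite size_del//;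
      move: (ltn_ord i); rewrite -/n; lia.
    rewrite del_pi_r//.
    over.
  under [X in _ + X]eq_bigr => i _.
    rewrite nth_pi_r ?(ltn_trans (ltn_ord i))//
      del_pi_r ?(ltn_trans (ltn_ord i))//.
    have -> : (n + j).-1 = (n + j.-1)%N by move: (ltn_ord i); lia.
    rewrite del_pi_r; last by move: (ltn_ord i) (ltn_ord j); lia.
    over.
  rewrite sumr_const card_ord.
  over.
rewrite big_split /= sumr_const card_ord; congr (_ + _).
  by rewrite sumrMnl.
by rewrite sumrMnr -bin2_sum big_mkord.
Qed.

End Derivation.

Section Twisting.
Variables (K : numFieldType) (g : dg_data K).
Hypothesis hg : low_degree_calculus g.
Variables (pi : g) (X : seq g -> g).
Hypotheses (hpi : maurer_cartan pi) (hX : Linf_derivation X).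

Implicit Types (s : seq (int * g)) (u : seq g).

Definition partial_twisted u N : g := \sum_(p < N) twisted_term X pi u p.
Local Notation T := partial_twisted.

Lemma brak_pi_pi : dg_brak pi pi = (- 2) *: dg_diff pi.
Proof.
have /eqP := hpi.2; rewrite addrC addr_eq0 => /eqP E.
by rewrite scaleNr -scalerN -E scalerA mulfV ?scale1r// pnatr_eq0.
Qed.

Lemma X_linear_head p s (c : K) a b : homogeneous s ->
  dg_comp p a -> dg_comp p b ->
  X ((c *: a + b) :: unzip2 s) = c *: X (a :: unzip2 s) + X (b :: unzip2 s).
Proof. exact: (Linf_linear hX (s := [::])). Qed.

Lemma partial_twistedZ p s (c : K) a N : homogeneous s -> dg_comp p a ->
  T (c *: a :: unzip2 s) N = c *: T (a :: unzip2 s) N.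
Proof.
move=> hs ha; rewrite scaler_sumr; apply: eq_bigr => n _.
rewrite /twisted_term scalerA mulrC -scalerA; congr (_ *: _); rewrite /=
  unzip2_pi.
apply: (linear_onZ hg (p := p) (L := fun a => X (a :: _))) => // d x y hx hy.
by apply: X_linear_head hx hy; apply/homogeneous_cat; split=> //;
  exact: homogeneous_pi.
Qed.

                                                                             
                                                                            
                                                                             
                                                                 
Lemma commute_partial s N : homogeneous s -> odd_degrees s ->
  let u := unzip2 s in let n := size u in
  dg_diff (T u N.+2) +
    (\sum_(i < n) dg_brak (nth 0 u i) (T (del i u) N.+2) +
     dg_brak pi (T u N.+1)) =
  \sum_(i < n) T (dg_diff (nth 0 u i) :: del i u) N.+2 +
  (\sum_(j < n) \sum_(i < j)
     T (dg_brak (nth 0 u i) (nth 0 u j) :: del j.-1 (del i u)) N.+2 +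
   (\sum_(i < n) T (dg_brak (nth 0 u i) pi :: del i u) N.+1 +
    twisted_term X pi (dg_diff pi :: u) N)).
Proof.
move=> hs os u n.
have hdel i : homogeneous (delete i s) by exact: homogeneous_delete.
have E p := commute_pi hg hpi hX p hs os; rewrite /= -/u -/n in E.
have {}E := @eq_bigr _ 0 +%R _ (index_enum 'I_N.+2) xpredT _ _
  (fun (p : 'I_N.+2) (_ : true) =>
  congr1 ( *:%R (p`!%:R : K)^-1) (E p)); move: E => /=.
under eq_bigr do rewrite !scalerDr.
under [X in _ = X -> _]eq_bigr do rewrite !scalerDr.
rewrite !big_split /=.
rewrite (sum_fact1 (fun p => dg_brak pi (X (u ++ nseq p pi)))).
rewrite (sum_fact1 (fun p => X (dg_diff pi :: u ++ nseq p pi))).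
rewrite (sum_fact2 (fun p => X (dg_brak pi pi :: u ++ nseq p pi))).
have comp_X p : dg_comp (series_degree s) (X (u ++ nseq p pi)) by exact:
  X_pi_comp.
rewrite -(linear_on_sum hg (diff_linear hg (p := series_degree s))
  N.+2 (fun p : nat => (p`!%:R)^-1) comp_X).
rewrite -(linear_on_sum hg (fun c a b =>
  brak_linear hg (q := series_degree s) c hpi.1)
  N.+1 (fun p : nat => (p`!%:R)^-1) comp_X).
have -> : \sum_(p < N.+2) (p`!%:R)^-1 *:
      \sum_(i < n) dg_brak (nth 0 u i) (X (del i u ++ nseq p pi)) =
    \sum_(i < n) dg_brak (nth 0 u i) (T (del i u) N.+2).
  under eq_bigr do rewrite scaler_sumr.
  rewrite exchange_big; apply: eq_bigr => i _ /=.
  have i_s : (i < size s)%N by rewrite -(size_map snd s) ltn_ord.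
  have a_i : nth (0, 0) s i \in s by exact: mem_nth.
  have E : nth 0 u i = (nth (0, 0) s i).2.
    by rewrite (nth_map (0, 0)).
  apply/esym/(linear_on_sum hg (p := series_degree (delete i s))
    (L := dg_brak (nth 0 u i)) _
     N.+2 (fun p : nat => (p`!%:R)^-1)
       (a := fun p => X (del i u ++ nseq p pi))).
    move=> c a b ha hb; apply: brak_linear hg _ _ _ _ _ _ _ ha hb.
    by rewrite E; exact: hs.
  by move=> p; rewrite -unzip2_delete; exact: X_pi_comp.
have -> : \sum_(p < N.+2) (p`!%:R)^-1 *:
      \sum_(i < n) X (dg_diff (nth 0 u i) :: del i u ++ nseq p pi) =
    \sum_(i < n) T (dg_diff (nth 0 u i) :: del i u) N.+2.
  under eq_bigr do rewrite scaler_sumr.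
  by rewrite exchange_big.
have -> : \sum_(p < N.+2) (p`!%:R)^-1 *: \sum_(j < n) \sum_(i < j)
     X (dg_brak (nth 0 u i) (nth 0 u j) :: del j.-1 (del i u) ++ nseq p pi) =
   \sum_(j < n) \sum_(i < j)
     T (dg_brak (nth 0 u i) (nth 0 u j) :: del j.-1 (del i u)) N.+2.
  under eq_bigr do rewrite scaler_sumr.
  rewrite exchange_big; apply: eq_bigr => j _ /=.
  under eq_bigr do rewrite scaler_sumr.
  by rewrite exchange_big.
have -> : \sum_(p < N.+2) (p`!%:R)^-1 *:
      (\sum_(i < n) X (dg_brak (nth 0 u i) pi :: del i u ++ nseq p.-1 pi) *+ p)
        =
    \sum_(i < n) T (dg_brak (nth 0 u i) pi :: del i u) N.+1.
  under eq_bigr do rewrite scaler_sumr.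
  rewrite exchange_big; apply: eq_bigr => i _ /=.
  exact: (sum_fact1 (fun p => X
    (dg_brak (nth 0 u i) pi :: del i u ++ nseq p pi))).
move=> ->; rewrite -!addrA; congr (_ + _).
rewrite addrCA; congr (_ + _); rewrite addrCA; congr (_ + _).
rewrite big_ord_recr /= -[X in X + _ + _]scale1r.
have -> : \sum_(p < N) (p`!%:R)^-1 *: X (dg_brak pi pi :: u ++ nseq p pi) =
    (-2) *: \sum_(p < N) (p`!%:R)^-1 *: X (dg_diff pi :: u ++ nseq p pi).
  by rewrite brak_pi_pi; exact: partial_twistedZ hs (diff_degree1 hg hpi.1).
rewrite scale1r scalerA mulrN mulVf ?pnatr_eq0// scaleN1r addrAC subrr add0r.
by [].
Qed.

End Twisting.

Section Limits.
Variables (K : numFieldType) (g : dg_data K).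
Hypothesis hg : low_degree_calculus g.
Variable to : (nat -> g) -> g -> Prop.
Hypothesis hto : admissible_convergence to.

                                                                             
                                                         
Definition lim_in p (a : nat -> g) (b : g) :=
  [/\ forall n, dg_comp p (a n), dg_comp p b & to a b].

Lemma lim_in_unique p q a b c : lim_in p a b -> lim_in q a c -> b = c.
Proof.
by move=> [_ hb ab] [_ hc ac]; exact (conv_unique hto hb hc ab ac).
Qed.

Lemma lim_inZ p (c : K) a b : lim_in p a b ->
  lim_in p (fun n => c *: a n) (c *: b).
Proof.
move=> [ha hb ab]; split=> [n||]; try exact: comp_scale.
have := conv_linear hto c ha (fun=> comp0 hg p) hb (comp0 hg p) ab
  (conv_cst hto (comp0 hg p)).
by rewrite addr0; congr to; apply/funext => n; rewrite addr0.
Qed.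

Lemma lim_inD p a b a' b' : lim_in p a b -> lim_in p a' b' ->
  lim_in p (fun n => a n + a' n) (b + b').
Proof.
move=> [ha hb ab] [ha' hb' ab']; split=> [n||]; try exact: comp_add.
have := conv_linear hto 1 ha ha' hb hb' ab ab'.
by rewrite scale1r; congr to; apply/funext => n; rewrite scale1r.
Qed.

Lemma lim_inB p a b a' b' : lim_in p a b -> lim_in p a' b' ->
  lim_in p (fun n => a n - a' n) (b - b').
Proof.
move=> la la'; have := lim_inD la (lim_inZ (-1) la').
by rewrite scaleN1r; congr lim_in; apply/funext => n; rewrite scaleN1r.
Qed.

Lemma lim_inS p a b : lim_in p a b -> lim_in p (fun n => a n.+1) b.
Proof. by move=> [ha hb ab]; split=> //; apply/(conv_shift hto ha hb). Qed.

Lemma lim_in_diff p q a b : (forall c, dg_comp p c ->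
  dg_comp q (dg_diff (c : g))) ->
  lim_in p a b -> lim_in q (fun n => dg_diff (a n)) (dg_diff b).
Proof.
by move=> pq [ha hb ab]; split=> [n||];
  [exact/pq|exact/pq|exact (conv_diff hto ha hb ab)].
Qed.

Lemma lim_in_brak p q r e a b : dg_comp r e ->
  (forall c, dg_comp p c -> dg_comp q (dg_brak e (c : g))) ->
  lim_in p a b -> lim_in q (fun n => dg_brak e (a n)) (dg_brak e b).
Proof.
by move=> he pq [ha hb ab]; split=> [n||];
  [exact/pq|exact/pq|exact (conv_brak hto he ha hb ab)].
Qed.

Variables (pi : g) (X : seq g -> g).
Hypotheses (hpi : maurer_cartan pi) (hX : Linf_derivation X).
Hypothesis hconv : all_series_converge to X pi.
Hypothesis hnij : strong_nijenhuis to X pi.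
Local Notation T := (partial_twisted pi X).
Local Notation V := (value to X pi).
Local Notation Xpi := (twisted to X pi).

Lemma sum_ofE p u a : is_sum to p u a -> sum_of to u = a.
Proof.
move=> ua; have [q [hq uq]] : [set a | exists p, is_sum to p u a]%classic
  (sum_of to u).
  by apply: (@xgetPex _ 0); exists a; exists p.
by case: ua => ha; exact (conv_unique hto hq ha uq).
Qed.

Lemma lim_twisted s : homogeneous s -> s != [::] ->
  lim_in (series_degree s) (T (unzip2 s)) (Xpi (unzip2 s)).
Proof.
move=> hs s0; have [a hsa] := hconv.2 s hs s0.
rewrite /twisted (sum_ofE hsa); have [ha sa] := hsa; split=> // N.
apply: (comp_sum hg) => n; apply: (comp_scale hg); exact: (X_pi_comp hg hpi hX).
Qed.

Lemma lim_value : lim_in 1 (T [::]) V.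
Proof.
have [a hsa] := hconv.1; rewrite /value (sum_ofE hsa).
have [ha sa] := hsa; split=> // N.
apply: (comp_sum hg) => n; apply: (comp_scale hg).
by have := X_pi_comp hg hpi hX n (@homogeneous_nil _ _);
  rewrite /series_degree /total_degree big_nil.
Qed.

Lemma lim_twisted_term q s : series_degree s = q ->
  homogeneous s -> s != [::] ->
  lim_in q (twisted_term X pi (unzip2 s)) 0.
Proof.
move=> <- hs s0; have l := lim_twisted hs s0.
have := lim_inB (lim_inS l) l; rewrite subrr; congr lim_in; apply/funext => N.
by rewrite /T /partial_twisted big_ord_recr addrAC subrr add0r.
Qed.

Lemma value_comp : dg_comp 1 V. Proof. by case: lim_value. Qed.

Lemma homogeneous1 p a : dg_comp p a -> homogeneous [:: (p, a : g)].
Proof. by move=> ha; apply/homogeneous_cons; split. Qed.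

Lemma homogeneous2 p a q b : dg_comp p a -> dg_comp q b ->
  homogeneous [:: (p, a : g); (q, b)].
Proof.
by move=> ha hb; apply/homogeneous_cons; split=> //; exact: homogeneous1.
Qed.

Lemma homogeneous3 p a q b r c : dg_comp p a -> dg_comp q b -> dg_comp r c ->
  homogeneous [:: (p, a : g); (q, b); (r, c)].
Proof.
by move=> ha hb hc; apply/homogeneous_cons; split=> //; exact: homogeneous2.
Qed.

Lemma lim_twisted1 p q a : q = p -> dg_comp p a ->
  lim_in q (T [:: a]) (Xpi [:: a]).
Proof.
move=> -> ha; have := lim_twisted (homogeneous1 ha) isT.
by rewrite /series_degree /total_degree big_seq1 /= addrK.
Qed.

Lemma lim_twisted2 r p a q b : r = p + q - 1 -> dg_comp p a -> dg_comp q b ->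
  lim_in r (T [:: a; b]) (Xpi [:: a; b]).
Proof.
move=> -> ha hb; have := lim_twisted (homogeneous2 ha hb) isT.
by rewrite /series_degree /total_degree big_cons big_seq1 /=; congr lim_in;
  ring.
Qed.

Lemma series_degree_sum (s : seq (int * g)) :
  series_degree s = foldr (fun x => +%R x.1) 0 s + 1 - (size s)%:Z.
Proof.
rewrite /series_degree /total_degree; congr (_ + _ - _).
by elim: s => [|x s IH]; rewrite ?big_nil// big_cons IH.
Qed.

Lemma partial_twisted0 s N : homogeneous s -> T (0 :: unzip2 s) N = 0.
Proof.
move=> hs; have := partial_twistedZ hg hpi hX 0 N hs (comp0 hg 0).
by rewrite !scale0r.
Qed.

                                                  
Lemma d_pi_value : dg_diff V + dg_brak pi V = 0.
Proof.
have d2 := diff_degree1 hg; have b2 := brak_comp hg hpi.1.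
have l := lim_value.
have lL := lim_inD (lim_inS (lim_inS (lim_in_diff d2 l)))
  (lim_inS (lim_in_brak hpi.1 b2 l)).
have lR := lim_twisted_term (series_degree_sum _) (homogeneous1 (d2 _ hpi.1))
  isT.
apply: (lim_in_unique lL (c := 0)); move: lR; congr lim_in; apply/funext => N.
have := commute_partial hg hpi hX N (s := [::]) (@homogeneous_nil _ _).
by rewrite /= !big_ord0 !add0r => ->.
Qed.

                                                                            
                                                    
Lemma d_pi_twisted f : dg_comp (- 1) f ->
  dg_brak f V + dg_brak pi (Xpi [:: f]) = Xpi [:: dg_brak f pi].
Proof.
move=> hf; have odd_f : odd_degrees [:: (-1, f)].
  by move=> x; rewrite inE => /eqP ->; left.
have fpi := brak_function_comp hg hf hpi.1.
have b0 := brak_function_comp hg hf.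
have b0' h : dg_comp (-1) h -> dg_comp 0 (dg_brak pi h).
  by move=> hh; rewrite (brak_functionC hg hh hpi.1);
    exact (brak_function_comp hg hh hpi.1).
have l1 := lim_twisted1 erefl hf.
have lL := lim_inD (lim_inS (lim_inS (lim_in_brak hf b0 lim_value)))
  (lim_inS (lim_in_brak hpi.1 b0' l1)).
have lR := lim_inD (lim_inS (lim_twisted1 erefl fpi))
  (lim_twisted_term (series_degree_sum _)
    (homogeneous2 (diff_degree1 hg hpi.1) hf) isT).
rewrite addr0 in lR.
apply: (lim_in_unique lL (q := 0)); move: lR; congr lim_in; apply/funext => N.
have := commute_partial hg hpi hX N (homogeneous1 hf) odd_f.
rewrite /= !big_ord_recl !big_ord0 /= !addr0 !add0r.
rewrite (diff_function hg hf) (partial_twisted0 _ (@homogeneous_nil _ _)) add0r.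
rewrite (diff_function hg) ?add0r => [<-//|].
by case: l1.
Qed.

                                                                              
                                                                          
                                                                            
Lemma twisted_brak_value f : dg_comp (- 1) f ->
  Xpi [:: dg_brak f V] = dg_brak V (Xpi [:: f]).
Proof.
move=> hf; have hV := value_comp; have hpi1 := hpi.1.
have odd_fV : odd_degrees [:: (-1, f); (1, V)].
  by move=> x; rewrite !inE => /orP[] /eqP ->; [left|right].
have fpi := brak_function_comp hg hf hpi1.
have fV := brak_function_comp hg hf hV.
have dV := diff_degree1 hg hV.
have bf := brak_function_comp hg hf.
have b0 (P h : g) : dg_comp 1 P -> dg_comp (-1) h -> dg_comp 0 (dg_brak P h).
  by move=> hP hh; rewrite (brak_functionC hg hh hP);
    exact (brak_function_comp hg hh hP).
have nij (s : seq (int * g)) : homogeneous s -> V \in unzip2 s ->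
  Xpi (unzip2 s) = 0 by exact: hnij.
have lV := lim_twisted1 erefl hV.
have lf := lim_twisted1 erefl hf.
have lfV := lim_twisted2 (r := -1) (p := -1) (q := 1) erefl hf hV.
have lfpi := lim_twisted2 (r := 0) (p := 0) (q := 1) erefl fpi hV.
rewrite (nij _ (homogeneous1 hV)) ?mem_head// in lV.
rewrite (nij _ (homogeneous2 hf hV)) ?inE ?eqxx ?orbT// in lfV.
rewrite (nij _ (homogeneous2 fpi hV)) ?inE ?eqxx ?orbT// in lfpi.
have lL := lim_inD (lim_inD (lim_inS (lim_inS (lim_in_brak hf bf lV)))
  (lim_inS (lim_inS (lim_in_brak hV (fun c => b0 V c hV) lf))))
  (lim_inS (lim_in_brak hpi1 (fun c => b0 pi c hpi1) lfV)).
have t1 := lim_twisted_term (series_degree_sum _) (homogeneous2 dV hf) isT.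
have t2 := lim_twisted_term (series_degree_sum _)
  (homogeneous3 (diff_degree1 hg hpi1) hf hV) isT.
have lR := lim_inD (lim_inD (lim_inS (lim_inS (lim_twisted1 erefl fV)))
  (lim_inS lfpi))
  (lim_inD (lim_inS t1) t2).
have brak_e0 (e : g) p : dg_comp p e -> dg_brak e 0 = 0 :> g.
  move=> he; apply: (linear_on0 hg (p := 0) (L := dg_brak e)) => c a b ha hb.
  exact (brak_linear hg c he ha hb).
rewrite (brak_e0 f (-1))// (brak_e0 pi 1)// !addr0 add0r in lL.
rewrite !addr0 in lR.
apply: esym; apply: (lim_in_unique lL (q := 0)); move: lR; congr lim_in;
  apply/funext => N.
have := commute_partial hg hpi hX N (homogeneous2 hf hV) odd_fV.
rewrite /= !big_ord_recl !big_ord0 /= !addr0 !add0r.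
rewrite /del /= (diff_function hg hf) (partial_twisted0 _ (homogeneous1 hV))
  add0r.
rewrite (diff_function hg (f := T [:: f; V] N.+2)) ?add0r; last by case: lfV.
have -> : dg_brak V pi = (-1) *: dg_diff V.
  rewrite (brakC hg hV hpi1) scaleN1r; apply/eqP.
  by rewrite -addr_eq0 addrC d_pi_value.
                                                                              
have TS : T [:: dg_diff V; f] N.+2 =
    T [:: dg_diff V; f] N.+1 + twisted_term X pi [:: dg_diff V; f] N.+1.
  by rewrite /partial_twisted big_ord_recr.
have := partial_twistedZ hg hpi hX (-1) N.+1 (homogeneous1 hf) dV.
rewrite /unzip2 [map _ _]/= => ->; rewrite TS scaleN1r => ->.
move: (T _ _) (T _ _) (T _ _) (twisted_term _ _ _ _) (twisted_term _ _ _ _).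
move=> t1' t2' t3 t4 t5.
by rewrite [RHS]addrCA -addrA addrACA [t1' + _]addrC subrK.
Qed.

Section Iterates.
Variables (f h : g).
Hypotheses (hf : dg_comp (- 1) f) (hh : dg_comp (- 1) h).
Hypotheses (hdf : twisted_diff pi f = 0) (hdh : twisted_diff pi h = 0).
Local Notation X1 := (fun a => Xpi [:: a]).

Lemma iter_twisted_comp m a : dg_comp (- 1) a -> dg_comp (- 1) (iter m X1 a).
Proof. by move=> ha; elim: m => //= m IH; case: (lim_twisted1 erefl IH). Qed.

Lemma brak_pi_closed a : dg_comp (- 1) a -> twisted_diff pi a = 0 ->
  dg_brak pi a = 0.
Proof. by move=> ha; rewrite /twisted_diff (diff_function hg ha) add0r. Qed.

Lemma twistedZ p c a : dg_comp p a -> Xpi [:: c *: a] = c *: Xpi [:: a].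
Proof.
move=> ha; have := lim_inZ c (lim_twisted1 erefl ha).
apply: (lim_in_unique (p := p)).
have := lim_twisted1 erefl (comp_scale hg c ha); congr lim_in; apply/funext =>
  N.
exact (partial_twistedZ hg hpi hX c N (@homogeneous_nil _ _) ha).
Qed.

                                                                       
                                         
Lemma brak_pi_iter m a : dg_comp (- 1) a -> twisted_diff pi a = 0 ->
  dg_brak pi (iter m.+1 X1 a) = (- m.+1%:R) *: dg_brak V (iter m X1 a).
Proof.
move=> ha da; have hV := value_comp; have hpi1 := hpi.1.
have step b : dg_comp (-1) b -> dg_brak pi (X1 b) =
  X1 (dg_brak pi b) - dg_brak V b.
  move=> hb; apply/eqP; rewrite -subr_eq0 opprB addrCA addrA.
  rewrite (brak_functionC hg hb hV) (brak_functionC hg hb hpi1).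
  by rewrite (d_pi_twisted hb) subrr.
elim: m => [|m IH].
  rewrite step//= brak_pi_closed//; have := twistedZ 0 (comp0 hg 0).
  by rewrite !scale0r => ->; rewrite sub0r scaleN1r.
have hm := iter_twisted_comp m ha.
rewrite step ?IH; last exact (iter_twisted_comp m.+1 ha).
rewrite (twistedZ (p := 0)); last first.
  by rewrite (brak_functionC hg hm hV); exact (brak_function_comp hg hm hV).
rewrite (brak_functionC hg hm hV) (twisted_brak_value hm).
rewrite -[Xpi [:: iter m X1 a]]/(iter m.+1 X1 a).
by rewrite -[X in _ - X]scale1r -scalerBl -opprD natr1.
Qed.

                                                                        
                                                       
                                                 
Lemma value_bracket_iter m l :
  dg_brak (iter m X1 f) (dg_brak V (iter l X1 h)) = 0.
Proof.
have hV := value_comp; have hpi1 := hpi.1.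
have comp_b (P b : g) : dg_comp 1 P -> dg_comp (-1) b ->
  dg_comp 0 (dg_brak P b).
  by move=> hP hb; rewrite (brak_functionC hg hb hP);
    exact (brak_function_comp hg hb hP).
have brakZ c (a b : g) : dg_comp (-1) a -> dg_comp 0 b -> dg_brak a (c *: b) =
  c *: dg_brak a b.
  move=> ha; apply: (linear_onZ hg (L := dg_brak a)) => d x y hx hy.
  exact (brak_linear hg d ha hx hy).
have n0 n : (n.+1%:R : K) != 0 by rewrite pnatr_eq0.
have hfm n := iter_twisted_comp n hf; have hhl n := iter_twisted_comp n hh.
have swap n k : k.+1%:R *: dg_brak (iter n X1 f) (dg_brak V (iter k X1 h)) =
    dg_brak (iter k.+1 X1 h) (dg_brak pi (iter n X1 f)).
  rewrite (brak_anti hg (hhl k.+1) (hfm n) hpi1) brak_pi_iter// brakZ//;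
    last exact (comp_b _ _ hV (hhl k)).
  by rewrite scaleNr opprK.
elim: m l => [|m IH] l; apply: (scalerI (n0 l)); rewrite scaler0 swap.
  rewrite brak_pi_closed//; have := brakZ 0 _ _ (hhl l.+1) (comp0 hg 0).
  by rewrite !scale0r.
rewrite brak_pi_iter// brakZ//; last exact (comp_b _ _ hV (hfm m)).
by rewrite (brak_anti hg (hhl l.+1) (hfm m) hV) IH oppr0 scaler0.
Qed.

Theorem pi_bracket_iter m l : pi_bracket pi (iter m X1 f) (iter l X1 h) = 0.
Proof.
have hV := value_comp; have hpi1 := hpi.1.
have brakZ c (a b : g) : dg_comp (-1) a -> dg_comp 0 b -> dg_brak a (c *: b) =
  c *: dg_brak a b.
  move=> ha; apply: (linear_onZ hg (L := dg_brak a)) => d x y hx hy.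
  exact (brak_linear hg d ha hx hy).
have hfm := iter_twisted_comp m hf; rewrite /pi_bracket.
case: l => [|l]; first by rewrite brak_pi_closed//
  -(scale0r 0) brakZ ?scale0r//; exact: comp0.
have hhl := iter_twisted_comp l hh.
rewrite brak_pi_iter// brakZ ?value_bracket_iter ?scaler0//.
by rewrite (brak_functionC hg hhl hV); exact (brak_function_comp hg hhl hV).
Qed.
End Iterates.

End Limits.

                            

Section Formal.

Lemma sum_triangle (V : zmodType) (F : nat -> nat -> V) n :
  \sum_(i < n.+1) \sum_(j < (n - i).+1) F i j =
  \sum_(j < n.+1) \sum_(i < (n - j).+1) F i j.
Proof.
have widen (G : nat -> V) i : (i <= n)%N ->
    \sum_(j < (n - i).+1) G j = \sum_(j < n.+1 | (i + j <= n)%N) G j.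
  move=> i_n; rewrite (big_ord_widen n.+1 G); last by rewrite ltnS leq_subr.
  apply: eq_bigl => j.
  rewrite ltnS.
  exact: leq_subRL.
under eq_bigr => i _ do rewrite (widen (F i) i (leq_ord i)).
rewrite (exchange_big_dep xpredT) //=; apply: eq_bigr => j _.
rewrite (widen (fun i => F i j) j (leq_ord j)).
by apply: eq_bigl => i; rewrite addnC.
Qed.

                                                     
Lemma sum_triangle_sym (V : zmodType) (F : nat -> nat -> nat -> V) n :
  \sum_(i < n.+1) \sum_(j < (n - i).+1) F i j (n - i - j)%N =
  \sum_(i < n.+1) \sum_(j < (n - i).+1) F (n - i - j)%N j i.
Proof.
rewrite (sum_triangle (fun i j => F i j (n - i - j)%N)).
rewrite (sum_triangle (fun i j => F (n - i - j)%N j i)).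
apply: eq_bigr => j _; rewrite (reindex_inj rev_ord_inj) /=.
by apply: eq_bigr => i _; congr (F _ _ _); move: (ltn_ord i) (ltn_ord j); lia.
Qed.

                                                                               
                                                                            
Lemma formal_calculus (K : numFieldType) (g : dg_data K) :
  low_degree_calculus g -> low_degree_calculus (formal g).
Proof.
move=> hg.
have sumC (F : nat -> nat -> g) n :
    \sum_(i < n.+1) F i (n - i)%N = \sum_(i < n.+1) F (n - i)%N i.
  rewrite (reindex_inj rev_ord_inj) /=; apply: eq_bigr => i _.
  by rewrite subSS subKn// leq_ord.
have compS p N (a : nat -> g) : (forall n, dg_comp p (a n)) ->
  dg_comp p (\sum_(n < N) a n).
  by exact: comp_sum.
split.
- by move=> p c a b ha hb n; exact (comp_linear hg c (ha n) (hb n)).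
- by move=> p n; exact (comp0 hg p).
- move=> p q c e a b he ha hb; apply/funext => n.
  have -> : (c *: dg_brak e a + dg_brak e b : formal g) n =
    c *: (dg_brak e a n) + dg_brak e b n by [].
  rewrite /= scaler_sumr -big_split; apply: eq_bigr => i _ /=.
  exact: (brak_linear hg c (he i) (ha _) (hb _)).
- move=> p c a b ha hb; apply/funext => n.
  exact: (diff_linear hg c (ha n) (hb n)).
- by move=> f hf; apply/funext => n; exact (diff_function hg (hf n)).
- by move=> P hP n; exact (diff_degree1 hg (hP n)).
- move=> f P hf hP n; apply: (compS 0 n.+1
  (fun i => dg_brak (f i) (P (n - i)%N))) => i.
  exact (brak_function_comp hg (hf i) (hP _)).
- move=> P Q hP hQ n; apply: (compS 2 n.+1
  (fun i => dg_brak (P i) (Q (n - i)%N))) => i.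
  exact (brak_comp hg (hP i) (hQ _)).
- move=> f P hf hP; apply/funext => n /=.
  rewrite (sumC (fun i j => dg_brak (P i) (f j))); apply: eq_bigr => i _.
  exact (brak_functionC hg (hf _) (hP _)).
- move=> P Q hP hQ; apply/funext => n /=.
  rewrite (sumC (fun i j => dg_brak (P i) (Q j))); apply: eq_bigr => i _.
  exact (brakC hg (hP _) (hQ _)).
- move=> f h P hf hh hP; apply/funext => n.
  have -> : (- dg_brak h (dg_brak P f) : formal g) n =
    - (dg_brak h (dg_brak P f) n) by [].
  have expand (a b : nat -> g) : (forall n, dg_comp (-1) (a n)) ->
    (forall n, dg_comp (-1) (b n)) ->
      (dg_brak (a : formal g) (dg_brak (P : formal g) b) : nat -> g) n =
      \sum_(i < n.+1) \sum_(j < (n - i).+1) dg_brak (a i)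
        (dg_brak (P j) (b (n - i - j)%N)).
    move=> ha hb; apply: eq_bigr => i _ /=.
    have b0 j : dg_comp 0 (dg_brak (P j) (b (n - i - j)%N)).
      by rewrite (brak_functionC hg (hb _) (hP j));
        exact: (brak_function_comp hg (hb _) (hP _)).
    have /= := linear_on_sum hg (fun c x y => brak_linear hg c (ha i) (q := 0))
      (n - i).+1 (fun=> 1) b0.
    by under eq_bigr do rewrite scale1r; move=> ->;
      under eq_bigr do rewrite scale1r.
  rewrite (expand f h hf hh) (expand h f hh hf).
  rewrite (sum_triangle_sym (fun i j l => dg_brak (f i) (dg_brak (P j) (h l)))).
  rewrite -sumrN; apply: eq_bigr => i _; rewrite -sumrN; apply: eq_bigr => j _.
  exact (brak_anti hg (hf _) (hh _) (hP _)).
Qed.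

End Formal.

                                                       

Import numFieldNormedType.Exports.
Local Open Scope classical_set_scope.
Local Open Scope ring_scope.

Section Calculus.
Variables (R : realType) (n : nat).
Local Notation E := ('rV[R]_n).
Local Notation e_ i := (delta_mx 0 i : E).
Implicit Types (F : E -> R) (U W : set E) (x y k : E) (i j : 'I_n).

Lemma is_derive_line F y v (s : R) : derivable F (y + s *: v) v ->
  is_derive s 1 (fun t : R => F (y + t *: v)) ('D_v F (y + s *: v)).
Proof.
move=> dF.
have E1 : (fun h : R => h^-1 *:
  (((fun t : R => F (y + t *: v)) \o shift s) (h *: 1) -
      F (y + s *: v))) =
    (fun h => h^-1 *: ((F \o shift (y + s *: v)) (h *: v) - F (y + s *: v))).
  apply/funext => h /=; congr (_ *: (F _ - _)).
  by rewrite [h *: 1]mulr1 scalerDl addrCA.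
by split; rewrite ?/derivable ?/derive E1.
Qed.

Lemma mean_value_line F y i (t : R) :
  (forall s : R, `|s| <= `|t| -> derivable F (y + s *: e_ i) (e_ i)) ->
  exists2 s : R, `|s| <= `|t| &
    F (y + t *: e_ i) - F y = t * 'D_(e_ i) F (y + s *: e_ i).
Proof.
move=> dF.
pose f (s : R) := F (y + s *: e_ i).
pose df (s : R) : R := 'D_(e_ i) F (y + s *: e_ i).
have fP (s : R) : `|s| <= `|t| -> is_derive s 1 f (df s) by move=> /dF;
  exact: is_derive_line.
have f0 : F y = f 0 by rewrite /f scale0r addr0.
have cf (a b : R) : (forall s, s \in `[a, b] -> `|s| <= `|t|) ->
  {within `[a, b], continuous f}.
  move=> ab; apply: derivable_within_continuous => s /ab /fP ds;
    exact: ex_derive.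
have [t0|t0] := leP 0 t.
  have tt (s : R) : s \in `[0, t] -> `|s| <= `|t|.
    by rewrite in_itv/= => /andP[? ?]; rewrite !ger0_norm.
  have [|s /tt s_t E] := MVT_segment t0 _ (cf _ _ tt) (df := df).
    by move=> s /subset_itv_oo_cc /tt /fP.
  by exists s => //; rewrite f0 -/(f t) E subr0 mulrC.
have tt (s : R) : s \in `[t, 0] -> `|s| <= `|t|.
  by rewrite in_itv/= => /andP[? ?]; rewrite !ler0_norm ?lerN2// ltW.
have [|s /tt s_t E] := MVT_segment (ltW t0) _ (cf _ _ tt) (df := df).
  by move=> s /subset_itv_oo_cc /tt /fP.
by exists s => //; rewrite f0 -/(f t) -opprB E sub0r mulrN opprK mulrC.
Qed.

Definition in_box x k y := forall j, `|y 0 j - x 0 j| <= `|k 0 j|.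

                                                                               
                                                                 
                               
Lemma mean_value_box F x k :
  (forall y, in_box x k y -> forall i, derivable F y (e_ i)) ->
  exists xi : 'I_n -> E, (forall j, in_box x k (xi j)) /\
    F (x + k) - F x = \sum_j k 0 j * 'D_(e_ j) F (xi j).
Proof.
move=> dF; pose trunc m : E := \row_j (if (j < m)%N then k 0 j else 0).
have truncS (m : 'I_n) : trunc m.+1 = trunc m + k 0 m *: e_ m.
  apply/rowP => j; rewrite !mxE eqxx /= ltnS leq_eqVlt -val_eqE.
  case: eqVneq => [/val_inj ->|_] /=; first by rewrite ltnn add0r mulr1.
  by rewrite mulr0 addr0.
have box_trunc (m : 'I_n) (s : R) : `|s| <= `|k 0 m| ->
  in_box x k (x + trunc m + s *: e_ m).
  move=> sk j; rewrite !mxE eqxx /= -val_eqE.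
  case: eqVneq => [/val_inj ->|_] /=;
    first by rewrite ltnn addr0 mulr1 addrAC subrr add0r.
  by rewrite mulr0 addr0 addrAC subrr add0r; case: ifP; rewrite ?normr0.
have step (m : 'I_n) : exists y : E, in_box x k y /\
    F (x + trunc m.+1) - F (x + trunc m) = k 0 m * 'D_(e_ m) F y.
  have [s sk E] := @mean_value_line F (x + trunc m) m (k 0 m)
    (fun s sk => dF _ (box_trunc m s sk) m).
  by exists (x + trunc m + s *: e_ m); split;
    [exact: box_trunc|rewrite truncS addrA].
have [xi xiP] := choice step; exists xi; split=> [j|]; first by case: (xiP j).
rewrite -(eq_bigr _ (fun m _ => (xiP m).2)).
rewrite -(big_mkord xpredT (fun m => F (x + trunc m.+1) - F (x + trunc m))).
rewrite telescope_sumr//; congr (F _ - F _).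
  by congr (_ + _); apply/rowP => j; rewrite mxE ltn_ord.
by rewrite -[LHS]addr0; congr (_ + _); apply/rowP => j; rewrite !mxE.
Qed.

Lemma near_box x (P : set E) : (\forall y \near x, P y) ->
  exists2 d : R, 0 < d & forall y, (forall j, `|y 0 j - x 0 j| < d) -> P y.
Proof.
move=> /nbhs_ballP[d /= d0 dP]; exists d => // y yd; apply: dP; split=> // i j.
by rewrite /ball /= distrC ord1.
Qed.

Lemma cvg_row (T : Type) (Fil : set_system T) (FF : Filter Fil) (f : T -> E) x :
  (forall j, f t 0 j @[t --> Fil] --> x 0 j) -> f @ Fil --> x.
Proof.
move=> fx A /= /near_box[d d0 dA].
have : \forall t \near Fil, forall j, `|f t 0 j - x 0 j| < d.
  apply: filter_forall => j; move/cvgrPdist_lt : (fx j) => /(_ d d0).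
  by apply: filterS => t; rewrite distrC.
by apply: filterS => t; exact: dA.
Qed.

                                                                               
                                                                         
                                          
Lemma is_derive_comp U F (phi : E -> E) x v : open U -> U (phi x) ->
  (forall y, U y -> forall i, derivable F y (e_ i)) ->
  (forall i, {for phi x, continuous (fun y => 'D_(e_ i) F y)}) ->
  (forall j, derivable (fun y => phi y 0 j) x v) ->
  is_derive x v (fun y => F (phi y))
    (\sum_j 'D_v (fun y => phi y 0 j) x * 'D_(e_ j) F (phi x)).
Proof.
move=> oU Ux dF cF dphi.
pose k (h : R) := phi (h *: v + x) - phi x.
have kE h j : k h 0 j = phi (h *: v + x) 0 j - phi x 0 j by rewrite !mxE.
have kd j : h^-1 * k h 0 j @[h --> 0^'] --> 'D_v (fun y => phi y 0 j) x.
  by under eq_fun do rewrite kE; exact: dphi.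
have k0 j : k h 0 j @[h --> 0^'] --> (0 : R).
  have : h * (h^-1 * k h 0 j) @[h --> 0^'] --> 0 * 'D_v (fun y => phi y 0 j) x.
    by apply: cvgM (kd j); exact: nbhs_dnbhs.
  rewrite mul0r; apply: cvg_trans; apply: near_eq_cvg; near=> h.
  by rewrite mulVKf//; near: h; exact: nbhs_dnbhs_neq.
have [d d0 dU] := near_box (open_nbhs_nbhs (conj oU Ux)).
have kU : \forall h \near (0 : R)^', forall y, in_box (phi x) (k h) y -> U y.
  have : \forall h \near (0 : R)^', forall j, `|k h 0 j| < d.
    apply: filter_forall => j; move/cvgr0Pnorm_lt : (k0 j) => /(_ d d0).
    exact.
  by apply: filterS => h kh y hy; apply: dU => j;
    exact: le_lt_trans (hy j) (kh j).
                                                                              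
pose secant h (xi : 'I_n -> E) := (forall j, in_box (phi x) (k h) (xi j)) /\
  F (phi (h *: v + x)) - F (phi x) = \sum_j k h 0 j * 'D_(e_ j) F (xi j).
have [xi xiP] : {xi : R -> 'I_n -> E & forall h,
    (forall y, in_box (phi x) (k h) y -> U y) -> secant h (xi h)}.
  apply: (@choice _ _ (fun h xi => _ -> secant h xi)) => h.
  have [Uh|nUh] := pselect (forall y, in_box (phi x) (k h) y -> U y).
    have [xi [xibox xiE]] := mean_value_box (fun y hy => dF y (Uh y hy)).
    by exists xi => _; split=> //; rewrite -xiE /k [phi x + _]addrC subrK.
  by exists (fun=> 0) => /nUh.
have dcvg : h^-1 *: (((fun y => F (phi y)) \o shift x) (h *: v) - F (phi x))
  @[h --> 0^'] -->
    \sum_j 'D_v (fun y => phi y 0 j) x * 'D_(e_ j) F (phi x).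
  apply: cvg_trans (_ : \sum_j (h^-1 * k h 0 j) * 'D_(e_ j) F (xi h j)
    @[h --> 0^'] --> _).
    apply: near_eq_cvg; near=> h.
    have [_ /= ->] : secant h (xi h) by apply: xiP; near: h; exact: kU.
    by rewrite scaler_sumr; apply: eq_bigr => j _; rewrite -mulrA.
  apply: cvg_big => [|j _]; first exact: add_continuous.
  apply: cvgM; first exact: kd.
  apply: (cvg_comp (fun h => xi h j) (fun y => 'D_(e_ j) F y)); last exact: cF.
  apply: cvg_row => l; apply/cvgrPdist_lt => e e0.
  near=> h; rewrite distrC.
  have [/(_ j l)/le_lt_trans + _] : secant h (xi h) by apply: xiP; near: h;
    exact: kU.
  by apply; near: h; move/cvgr0Pnorm_lt : (k0 l); exact.
split; first by apply/cvg_ex; eexists; exact: dcvg.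
exact/cvg_lim.
Unshelve. all: by end_near. Qed.

Lemma Cr_subset r U W F : W `<=` U -> Cr r U F -> Cr r W F.
Proof.
move=> WU; elim: r F => [|r IHr] F [cF dF]; split=> //; try by move=> x /WU /cF.
by move=> i; have [di Ci] := dF i; split=> [x /WU/di//|]; exact: IHr.
Qed.

Lemma Cr_sum r U (I : Type) (s : seq I) (F : I -> E -> R) : open U ->
  (forall a, Cr r U (F a)) -> Cr r U (fun x => \sum_(a <- s) F a x).
Proof.
move=> oU CF; elim: s => [|a s IHs].
  by under eq_fun do rewrite big_nil; exact: Cr_cst.
by under eq_fun do rewrite big_cons; exact: CrD.
Qed.

Lemma Cinfty_derive U F i : Cinfty U F -> Cinfty U (fun x => 'D_(e_ i) F x).
Proof. by move=> CF r; have [_ /(_ i)[]] := CF r.+1. Qed.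

Lemma Cinfty_continuous U F x : Cinfty U F -> U x -> {for x, continuous F}.
Proof. by move=> CF; have [cF _] := CF 0%N; exact: cF. Qed.

Lemma Cinfty_derivable U F x i : Cinfty U F -> U x -> derivable F x (e_ i).
Proof. by move=> CF; have [_ /(_ i)[+ _]] := CF 1%N; exact. Qed.

Lemma Cinfty_comp U W F (phi : E -> E) : open U -> open W ->
  (forall x, W x -> U (phi x)) ->
  (forall j, Cinfty W (fun x => phi x 0 j)) ->
  Cinfty U F -> Cinfty W (fun x => F (phi x)).
Proof.
move=> oU oW WU Cphi CF r.
have cphi x : W x -> {for x, continuous phi}.
  move=> Wx; apply: (@cvg_row _ _ (nbhs_filter x)) => j.
  exact: Cinfty_continuous (Cphi j) Wx.
have dcomp G x i : Cinfty U G -> W x -> is_derive x (e_ i) (fun y => G (phi y))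
    (\sum_j 'D_(e_ i) (fun y => phi y 0 j) x * 'D_(e_ j) G (phi x)).
  move=> CG Wx; apply: (is_derive_comp oU (WU _ Wx)).
  - by move=> y Uy j; exact: Cinfty_derivable CG Uy.
  - by move=> j; apply: Cinfty_continuous (Cinfty_derive j CG) (WU _ Wx).
  - by move=> j; exact: Cinfty_derivable (Cphi j) Wx.
have ccomp G : Cinfty U G -> forall x, W x ->
  {for x, continuous (fun x => G (phi x))}.
  by move=> CG x Wx; apply: continuous_comp (cphi x Wx) _;
    exact: Cinfty_continuous CG (WU _ Wx).
elim: r F CF => [|r IHr] F CF; split=> //; try exact: ccomp.
move=> i; split=> [x Wx|]; first by have := dcomp F x i CF Wx => -[].
have CD : Cr r W (fun x => \sum_j 'D_(e_ i) (fun y => phi y 0 j) x * 'D_(e_ j) F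
  (phi x)).
  apply: Cr_sum => // j; apply: CrM => //;
    first exact: (Cinfty_derive i (Cphi j)).
  exact: IHr (Cinfty_derive j CF).
by apply: Cr_congr CD => // x /set_mem Wx; have := dcomp F x i CF Wx => -[_ <-].
Qed.

Lemma increment_bound F y i (t c e : R) :
  (forall s : R, `|s| <= `|t| -> derivable F (y + s *: e_ i) (e_ i)) ->
  (forall s : R, `|s| <= `|t| -> `|'D_(e_ i) F (y + s *: e_ i) - c| <= e) ->
  `|F (y + t *: e_ i) - F y - t * c| <= e * `|t|.
Proof.
move=> dF De; have [s st ->] := mean_value_line dF.
by rewrite -mulrBr normrM mulrC ler_wpM2r// De.
Qed.

Lemma is_derive_translate F y v z : derivable F (y + z) v ->
  is_derive y v (fun y => F (y + z)) ('D_v F (y + z)).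
Proof.
move=> dF.
have E1 : (fun h : R => h^-1 *:
  (((fun y => F (y + z)) \o shift y) (h *: v) - F (y + z))) =
    (fun h => h^-1 *: ((F \o shift (y + z)) (h *: v) - F (y + z))).
  by apply/funext => h /=; rewrite addrA.
by split; rewrite ?/derivable ?/derive E1.
Qed.

                                                                               
                                                                            
                                                             
Lemma second_difference U F x i j (e : R) : open U -> U x -> Cinfty U F ->
  0 < e ->
  \forall t \near (0 : R)^',
    `|F (x + t *: e_ i + t *: e_ j) - F (x + t *: e_ i) -
      (F (x + t *: e_ j) - F x)
      - t * (t * 'D_(e_ j) (fun y => 'D_(e_ i) F y) x)| <= e * `|t| * `|t|.
Proof.
move=> oU Ux CF e0; set c := 'D_(e_ j) _ x.
have Ci := Cinfty_derive i CF.
have Cji := Cinfty_derive j Ci.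
have [d d0 dP] : exists2 d : R, 0 < d & forall y,
  (forall l, `|y 0 l - x 0 l| < d) ->
    U y /\ `|'D_(e_ j) (fun y => 'D_(e_ i) F y) y - c| <= e.
  apply: near_box; near=> y; split; first by near: y; exact: open_nbhs_nbhs.
  rewrite distrC; near: y; move/cvgrPdist_le: (Cinfty_continuous Cji Ux) =>
    /(_ e e0).
  exact.
near=> t.
have t_d : `|t| < d / 2.
  by near: t; apply: dnbhs0_lt; rewrite divr_gt0.
                                                                          
have box (s s' : R) : `|s| <= `|t| -> `|s'| <= `|t| ->
    U (x + s *: e_ i + s' *: e_ j) /\
    `|'D_(e_ j) (fun y => 'D_(e_ i) F y) (x + s *: e_ i + s' *: e_ j) - c| <= e.
  move=> st st'; apply: dP => l; rewrite !mxE !eqxx /=.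
  rewrite (_ : _ - _ = s * (l == i)%:R + s' * (l == j)%:R); last by ring.
  rewrite [ltRHS]splitr (le_lt_trans (ler_normD _ _))// ltrD// normrM.
    by rewrite (le_lt_trans _ t_d)// (le_trans _ st)// ler_piMr//
      normr_nat lern1 leq_b1.
  by rewrite (le_lt_trans _ t_d)// (le_trans _ st')// ler_piMr//
    normr_nat lern1 leq_b1.
pose G y := F (y + t *: e_ j) - F y.
have U0 (s : R) : `|s| <= `|t| -> U (x + s *: e_ i).
  move=> st; have [] := box s 0 st; rewrite ?normr0// => + _.
  by rewrite scale0r addr0.
have dG (s : R) : `|s| <= `|t| -> is_derive (x + s *: e_ i) (e_ i) G
    ('D_(e_ i) F (x + s *: e_ i + t *: e_ j) - 'D_(e_ i) F (x + s *: e_ i)).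
  move=> st; have [Ust _] := box s t st (lexx _).
  have d1 := is_derive_translate (Cinfty_derivable (i := i) CF Ust).
  have d2 := derivableP (Cinfty_derivable (i := i) CF (U0 s st)).
  exact: is_deriveB d1 d2.
apply: (@increment_bound G x i t (t * c) (e * `|t|)) => s st.
  by have [] := dG s st.
have [_ ->] := dG s st.
apply: (@increment_bound (fun y => 'D_(e_ i) F y) _ j t c e) => s' st'.
  by apply: Cinfty_derivable Ci _; have [] := box s s' st st'.
by have [] := box s s' st st'.
Unshelve. all: by end_near. Qed.

                                                                               
                 
Lemma derive_comm U F x i j : open U -> U x -> Cinfty U F ->
  'D_(e_ i) (fun y => 'D_(e_ j) F y) x = 'D_(e_ j) (fun y => 'D_(e_ i) F y) x.
Proof.
move=> oU Ux CF; apply/eqP; rewrite -subr_eq0 -normr_le0.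
apply/ler_addgt0Pl => e e0; rewrite addr0.
have e2 : 0 < e / 2 by rewrite divr_gt0.
have nt0 : \forall t \near (0 : R)^', t != 0 by exact: nbhs_dnbhs_neq.
have [t [[b1 b2] t0]] := @filter_ex _ _ _ _ (filterI (filterI
  (second_difference j i oU Ux CF e2) (second_difference i j oU Ux CF e2)) nt0).
have tt : 0 < `|t| * `|t| by rewrite mulr_gt0// normr_gt0.
rewrite -(ler_pM2r tt) -!normrM.
move: b1 b2; rewrite [x + t *: e_ j + _]addrAC.
set a := F _; set b := F _; set b' := F _; set c := 'D_ _ _ _; set c' :=
  'D_ _ _ _.
move=> b1 b2; clearbody a b b' c c'.
have -> : (c - c') * (t * t) =
    (a - b' - (b - F x) - t * (t * c')) - (a - b - (b' - F x) - t * (t * c)) by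
      ring.
rewrite (le_trans (ler_normB _ _))//.
rewrite [leRHS](_ : _ = e / 2 * `|t| * `|t| + e / 2 * `|t| * `|t|).
  exact: lerD b2 b1.
by rewrite normrM; field.
Qed.

End Calculus.

                                       

Section GroundField.
Variables (R : realType) (k : ground).
Local Notation K := (ground_field R k).

                                                                       
                                                             
Lemma ground_ext (a b : K) : re_part a = re_part b -> im_part a = im_part b ->
  a = b.
Proof. by case: k a b => //= -[? ?] [? ?] /= -> ->. Qed.

Lemma re_of_parts (x y : R) : re_part (of_parts k x y) = x.
Proof. by case: k. Qed.
End GroundField.

Section Partial.
Variables (R : realType) (k : ground) (M : manifold R).
Local Notation K := (ground_field R k).
Local Notation E := ('rV[R]_(dim M)).
Local Notation e_ i := (delta_mx 0 i : E).
Implicit Types (U : set E) (h : E -> K) (i j : 'I_(dim M)) (v : E).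

Lemma re_partial i h v :
  re_part (partial i h v) = 'D_(e_ i) (fun w => re_part (h w)) v.
Proof. exact: re_of_parts. Qed.

Lemma im_partial i h v :
  im_part (partial i h v) = 'D_(e_ i) (fun w => im_part (h w)) v.
Proof. by rewrite /partial; case: k h => //= h; rewrite derive_cst. Qed.

Definition ksmooth U h :=
  Cinfty U (fun v => re_part (h v)) /\ Cinfty U (fun v => im_part (h v)).

Lemma ksmooth_cst U a : open U -> ksmooth U (fun=> a).
Proof. by move=> oU; split=> r; exact: Cr_cst. Qed.

Lemma ksmoothD U h h' : open U -> ksmooth U h -> ksmooth U h' ->
  ksmooth U (fun v => h v + h' v).
Proof.
move=> oU [Rh Ih] [Rh' Ih']; split=> r.
  by under eq_fun do rewrite re_partD; exact: CrD.
by under eq_fun do rewrite im_partD; exact: CrD.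
Qed.

Lemma ksmoothM U h h' : open U -> ksmooth U h -> ksmooth U h' ->
  ksmooth U (fun v => h v * h' v).
Proof.
move=> oU [Rh Ih] [Rh' Ih']; split=> r.
  under eq_fun do rewrite re_partM; apply: CrD => //; first exact: CrM.
  by apply: CrM => //; [exact: Cr_cst|exact: CrM].
by under eq_fun do rewrite im_partM; apply: CrD => //; exact: CrM.
Qed.

Lemma ksmooth_partial U i h : ksmooth U h -> ksmooth U (partial i h).
Proof.
move=> [Rh Ih]; split; last by under eq_fun do rewrite im_partial;
  exact: Cinfty_derive.
by under eq_fun do rewrite re_partial; exact: Cinfty_derive.
Qed.

Lemma partial_near_eq i h h' v : {near v, h =1 h'} -> partial i h v =
  partial i h' v.
Proof.
move=> hh'; apply: ground_ext; rewrite ?re_partial ?im_partial.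
  by apply: near_eq_derive; apply: filterS hh' => w ->.
by apply: near_eq_derive; apply: filterS hh' => w ->.
Qed.

Lemma partial_cst i (a : K) v : partial i (fun=> a) v = 0.
Proof.
by apply: ground_ext; rewrite ?re_partial ?im_partial derive_cst; case: k.
Qed.

Section At.
Variables (U : set E) (h h' : E -> K) (v : E).
Hypotheses (Uv : U v) (Sh : ksmooth U h) (Sh' : ksmooth U h').

Let dR i : derivable (fun v => re_part (h v)) v (e_ i).
Proof. exact: Cinfty_derivable Sh.1 Uv. Qed.
Let dI i : derivable (fun v => im_part (h v)) v (e_ i).
Proof. exact: Cinfty_derivable Sh.2 Uv. Qed.
Let dR' i : derivable (fun v => re_part (h' v)) v (e_ i).
Proof. exact: Cinfty_derivable Sh'.1 Uv. Qed.
Let dI' i : derivable (fun v => im_part (h' v)) v (e_ i).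
Proof. exact: Cinfty_derivable Sh'.2 Uv. Qed.

Lemma partialD i : partial i (fun v => h v + h' v) v =
  partial i h v + partial i h' v.
Proof.
apply: ground_ext; rewrite ?re_partial ?im_partial.
  by rewrite re_partD !re_partial -(deriveD (@dR i) (@dR' i));
    under eq_fun do rewrite re_partD.
by rewrite im_partD !im_partial -(deriveD (@dI i) (@dI' i));
  under eq_fun do rewrite im_partD.
Qed.

Lemma product_rule_re (a b c d a' b' c' d' : R) :
  (a * b' + b * a') - (c * d' + d * c') =
  a' * b + -1 * (c' * d) + (a * b' + -1 * (c * d')).
Proof. ring. Qed.

Lemma product_rule_im (a b c d a' b' c' d' : R) :
  (a * d' + d * a') + (c * b' + b * c') =
  a' * d + c' * b + (a * d' + c * b').
Proof. ring. Qed.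

Lemma partialM i :
  partial i (fun v => h v * h' v) v =
    partial i h v * h' v + h v * partial i h' v.
Proof.
apply: ground_ext.
  rewrite re_partial re_partD !re_partM !re_partial !im_partial.
  have -> : (fun w => re_part (h w * h' w)) =
    (fun w => re_part (h w)) * (fun w => re_part (h' w))
     - (fun w => im_part (h w)) * (fun w => im_part (h' w)).
    by apply/funext => w; rewrite re_partM mulN1r.
  rewrite deriveB ?deriveM//; try exact: derivableM.
  exact: product_rule_re.
rewrite im_partial im_partD !im_partM !re_partial !im_partial.
have -> : (fun w => im_part (h w * h' w)) =
  (fun w => re_part (h w)) * (fun w => im_part (h' w))
   + (fun w => im_part (h w)) * (fun w => re_part (h' w)).
  by apply/funext => w; rewrite im_partM.
rewrite deriveD ?deriveM//; try exact: derivableM.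
exact: product_rule_im.
Qed.

Lemma partial_comm i j : open U -> partial i (partial j h) v =
  partial j (partial i h) v.
Proof.
move=> oU; have Rp l : (fun w => re_part (partial l h w)) =
    (fun w => 'D_(e_ l) (fun w => re_part (h w)) w).
  by apply/funext => w; exact: re_partial.
have Ip l : (fun w => im_part (partial l h w)) =
    (fun w => 'D_(e_ l) (fun w => im_part (h w)) w).
  by apply/funext => w; exact: im_partial.
apply: ground_ext.
  rewrite [LHS]re_partial [RHS]re_partial (Rp j) (Rp i);
    exact: derive_comm oU Uv Sh.1.
rewrite [LHS]im_partial [RHS]im_partial (Ip j) (Ip i);
  exact: derive_comm oU Uv Sh.2.
Qed.
End At.

Lemma ksmooth_comp U W (phi : E -> E) h : open U -> open W ->
  (forall v, W v -> U (phi v)) -> (forall j, Cinfty W (fun v => phi v 0 j)) ->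
  ksmooth U h -> ksmooth W (fun v => h (phi v)).
Proof.
move=> oU oW WU Cphi [Rh Ih].
by split; [exact: Cinfty_comp oU oW WU Cphi Rh|exact: Cinfty_comp oU oW WU Cphi
  Ih].
Qed.

Implicit Types (c : chart R M (dim M)) (V : set M) (u w : M -> K^o).

Lemma open_image c V : atlas c -> open V -> open (to_euc c @` (dom c `&` V)).
Proof.
move=> /atlas_chart Hc oV; rewrite openE => v [x [cx Vx] <-{v}].
have v_im : (to_euc c @` dom c) (to_euc c x) by exists x.
have ofx := chart_cancel Hc cx.
have /(_ V) nV := chart_inv_continuous Hc v_im.
have {}nV : \forall v \near to_euc c x, V (of_euc c v).
  by apply: nV; rewrite ofx; exact: open_nbhs_nbhs.
have := open_nbhs_nbhs (conj (chart_open_im Hc) v_im).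
apply: filter_app; apply: filterS nV => v Vv [y cy yv].
by exists y => //; split=> //; rewrite -(chart_cancel Hc cy) yv.
Qed.

Section OnOpen.
Variables (V : set M).
Hypothesis oV : open V.

Lemma smooth_on_cst (a : K) : smooth_on V (fun=> a : K^o).
Proof. by move=> c ac; apply: ksmooth_cst; exact: open_image. Qed.

Lemma smooth_onD u w : smooth_on V u -> smooth_on V w ->
  smooth_on V (fun y => u y + w y).
Proof.
by move=> Su Sw c ac; apply: ksmoothD; [exact: open_image|exact: Su|exact: Sw].
Qed.

Lemma smooth_onM u w : smooth_on V u -> smooth_on V w ->
  smooth_on V (fun y => u y * w y).
Proof.
by move=> Su Sw c ac; apply: ksmoothM; [exact: open_image|exact: Su|exact: Sw].
Qed.

Lemma smooth_on_subset W u : V `<=` W -> smooth_on W u -> smooth_on V u.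
Proof.
move=> VW Su c ac; have [Ru Iu] := Su c ac.
have sub : to_euc c @` (dom c `&` V) `<=` to_euc c @` (dom c `&` W).
  by apply: image_subset; exact: setIS.
by split=> r; [exact: Cr_subset sub (Ru r)|exact: Cr_subset sub (Iu r)].
Qed.

Variable ch : chart R M (dim M).
Hypotheses (ach : atlas ch) (Vch : V `<=` dom ch).

Definition chart_deriv i u : M -> K^o :=
  fun y => partial i (fun v => u (of_euc ch v)) (to_euc ch y).

Definition chart_derivs (I : seq 'I_(dim M)) u := foldr chart_deriv u I.

Let U := to_euc ch @` (dom ch `&` V).
Let oU : open U. Proof. exact: open_image. Qed.
Let UV y : V y -> U (to_euc ch y).
Proof. by move=> Vy; exists y => //; split=> //; exact: Vch. Qed.
Let of_toK y : V y -> of_euc ch (to_euc ch y) = y.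
Proof. by move=> /Vch; exact/chart_cancel/atlas_chart. Qed.
Let VU v : U v -> V (of_euc ch v).
Proof. by move=> [y [_ Vy] <-]; rewrite of_toK. Qed.
Let to_ofK v : U v -> to_euc ch (of_euc ch v) = v.
Proof. by move=> [y [_ Vy] <-]; rewrite of_toK. Qed.

Lemma deriv_congr i u w y : V y -> (forall z, V z -> u z = w z) ->
  chart_deriv i u y = chart_deriv i w y.
Proof.
move=> Vy uw; apply: partial_near_eq.
by near=> v; apply/uw/VU; near: v; apply: open_nbhs_nbhs; split=> //; exact: UV.
Unshelve. all: by end_near. Qed.

Lemma derivD i u w y : V y -> smooth_on V u -> smooth_on V w ->
  chart_deriv i (fun z => u z + w z) y = chart_deriv i u y + chart_deriv i w y.
Proof.
by move=> Vy Su Sw; exact: partialD (UV Vy) (Su _ ach) (Sw _ ach) i.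
Qed.

Lemma derivM i u w y : V y -> smooth_on V u -> smooth_on V w ->
  chart_deriv i (fun z => u z * w z) y =
    chart_deriv i u y * w y + u y * chart_deriv i w y.
Proof.
move=> Vy Su Sw; rewrite /chart_deriv
  (partialM (UV Vy) (Su _ ach) (Sw _ ach) i).
by rewrite of_toK.
Qed.

Lemma deriv_cst i (a : K) y : chart_deriv i (fun=> a) y = 0.
Proof. exact: partial_cst. Qed.

                                                                                
                                                        
Lemma smooth_on_deriv i u : smooth_on V u -> smooth_on V (chart_deriv i u).
Proof.
move=> Su c ac.
have oW := open_image ac oV.
have := @ksmooth_comp U _ (fun v => to_euc ch (of_euc c v))
  (partial i (fun v => u (of_euc ch v))) oU oW.
apply; last exact/ksmooth_partial/Su.
  move=> v [y [cy Vy] <-]; rewrite (chart_cancel (atlas_chart ac) cy);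
    exact: UV.
move=> j r; apply: Cr_subset (atlas_compatible ac ach j r).
by apply: image_subset; exact: setIS.
Qed.

Lemma smooth_on_derivs I u : smooth_on V u -> smooth_on V (chart_derivs I u).
Proof. by move=> Su; elim: I => //= i I; exact: smooth_on_deriv. Qed.

Lemma deriv_comm i j u y : V y -> smooth_on V u ->
  chart_deriv i (chart_deriv j u) y = chart_deriv j (chart_deriv i u) y.
Proof.
move=> Vy Su; rewrite /chart_deriv.
have E l : {near to_euc ch y,
  (fun v => partial l (fun v0 => u (of_euc ch v0)) (to_euc ch (of_euc ch v)))
    =1 partial l (fun v0 => u (of_euc ch v0))}.
  by near=> v; rewrite to_ofK//; near: v; apply: open_nbhs_nbhs; split=> //;
    exact: UV.
rewrite (partial_near_eq _ (E j)) (partial_near_eq _ (E i)).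
exact: partial_comm (UV Vy) (Su _ ach) _ _ oU.
Unshelve. all: by end_near. Qed.

Lemma partialsE I u y : V y ->
  partials I (fun v => u (of_euc ch v)) (to_euc ch y) = chart_derivs I u y.
Proof.
elim: I y => [|i I IH] y Vy /=; first by rewrite of_toK.
apply: partial_near_eq; near=> v.
have Uv : U v by near: v; apply: open_nbhs_nbhs; split=> //; exact: UV.
by rewrite -[in LHS](to_ofK Uv); apply/IH/VU.
Unshelve. all: by end_near. Qed.

End OnOpen.
End Partial.

                                                                

Section SmoothFun.
Variables (R : realType) (k : ground) (M : manifold R).
Local Notation K := (ground_field R k).
Local Notation A := (smooth_function k M).
Implicit Types (f g : A) (y : M).

Lemma smooth_fun_ext f g : (forall y, f y = g y) -> f = g.
Proof. by move=> fg; apply/val_inj/funext. Qed.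

Lemma smooth_funD f g y : (f + g) y = f y + g y. Proof. by []. Qed.
Lemma smooth_funN f y : (- f) y = - f y. Proof. by []. Qed.
Lemma smooth_funM f g y : (f * g) y = f y * g y. Proof. by []. Qed.
Lemma smooth_funZ (a : K) f y : (a *: f) y = a * f y. Proof. by []. Qed.

Lemma smooth_fun_sum (I : Type) (r : seq I) (P : pred I) (F : I -> A) y :
  (\sum_(i <- r | P i) F i) y = \sum_(i <- r | P i) F i y.
Proof. by elim/big_rec2: _ => // i a b _ <-. Qed.

Lemma smooth_fun_sign n f y : ((-1) ^+ n * f) y = (-1) ^+ n * f y.
Proof.
by rewrite -signr_odd -[in RHS]signr_odd; case: odd; rewrite ?mulN1r ?mul1r.
Qed.

Lemma smooth_on_fun (V : set M) f : smooth_on V f.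
Proof.
have := smooth_funP f; rewrite unfold_in => /asboolP; apply: smooth_on_subset.
exact: subsetT.
Qed.
End SmoothFun.

Section LocalForms.
Variables (R : realType) (k : ground) (M : manifold R).
Local Notation K := (ground_field R k).
Local Notation A := (smooth_function k M).
Local Notation index := (seq 'I_(dim M)).
Variable ch : chart R M (dim M).
Hypothesis ach : atlas ch.
Local Notation derivs := (@chart_derivs R k M ch).
Local Notation deriv := (@chart_deriv R k M ch).
Variable adm : pred index.
Implicit Types (s : seq A) (I : index).

                                                                             
                                                                               
                                
Definition form (V : set M) (m : nat) (F : seq A -> M -> K^o) : Prop :=
  exists (T : finType) (a : T -> M -> K^o) (J : T -> nat -> index),
  [/\ forall t, smooth_on V (a t),
      forall t j, (j < m)%N -> adm (J t j) &
      forall s, size s = m -> forall y, V y ->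
        F s y = \sum_t a t y * \prod_(j < m) derivs (J t j) (nth 0 s j) y].

Lemma form_subset V W m F : V `<=` W -> form W m F -> form V m F.
Proof.
move=> VW [T [a [J [Sa aJ FE]]]]; exists T, a, J; split=> //.
  by move=> t; exact: smooth_on_subset VW (Sa t).
by move=> s sm y /VW; exact: FE.
Qed.

Section OnV.
Variable V : set M.
Hypotheses (oV : open V) (Vch : V `<=` dom ch).
Local Notation form := (form V).

Lemma form_congr m F G : (forall s, size s = m -> forall y, V y -> F s y =
  G s y) ->
  form m F -> form m G.
Proof.
move=> FG [T [a [J [Sa aJ FE]]]]; exists T, a, J; split=> // s sm y Vy.
by rewrite -FG// FE.
Qed.

Lemma form_monomial m (a : M -> K^o) (J : nat -> index) : smooth_on V a ->
  (forall j, (j < m)%N -> adm (J j)) ->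
  form m (fun s y => a y * \prod_(j < m) derivs (J j) (nth 0 s j) y).
Proof.
move=> Sa aJ; exists unit, (fun=> a), (fun=> J); split=> // s _ y _.
by rewrite big_const card_unit /= addr0.
Qed.

Lemma form0 m : form m (fun _ _ => 0).
Proof.
exists void, (fun=> fun=> 0), (fun=> fun=> [::]); split=> // s _ y _.
by rewrite big1// => -[].
Qed.

Lemma formD m F G : form m F -> form m G -> form m (fun s y => F s y + G s y).
Proof.
move=> [T [a [J [Sa aJ FE]]]] [T' [a' [J' [Sa' aJ' GE]]]].
exists (T + T')%type, (fun t => match t with inl t => a t | inr t => a' t end),
  (fun t => match t with inl t => J t | inr t => J' t end).
split=> [[]|[] ? ? ?|s sm y Vy]//; try by [apply: aJ | apply: aJ'].
by rewrite FE// GE// big_sumType.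
Qed.

Lemma form_sum m (I : Type) (r : seq I) (F : I -> seq A -> M -> K^o) :
  (forall i, form m (F i)) -> form m (fun s y => \sum_(i <- r) F i s y).
Proof.
move=> FF; elim: r => [|i r IHr].
  by apply: form_congr (form0 m) => s _ y _; rewrite big_nil.
by apply: form_congr (formD (FF i) IHr) => s _ y _; rewrite big_cons.
Qed.

Lemma formM m (b : M -> K^o) F : smooth_on V b -> form m F ->
  form m (fun s y => b y * F s y).
Proof.
move=> Sb [T [a [J [Sa aJ FE]]]]; exists T, (fun t y => b y * a t y), J; split=>
  //.
  by move=> t; exact: smooth_onM.
by move=> s sm y Vy; rewrite FE// mulr_sumr; apply: eq_bigr => t _;
  rewrite mulrA.
Qed.

Lemma formZ m (b : K) F : form m F -> form m (fun s y => b * F s y).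
Proof. exact/formM/smooth_on_cst. Qed.

Lemma smooth_on_sum (I : Type) (r : seq I) (u : I -> M -> K^o) :
  (forall i, smooth_on V (u i)) -> smooth_on V (fun y => \sum_(i <- r) u i y).
Proof.
move=> Su; elim: r => [|i r IHr]; first by under eq_fun do rewrite big_nil;
  exact: smooth_on_cst.
by under eq_fun do rewrite big_cons; exact: (smooth_onD oV (Su i) IHr).
Qed.

Lemma smooth_on_prod (I : Type) (r : seq I) (u : I -> M -> K^o) :
  (forall i, smooth_on V (u i)) -> smooth_on V (fun y => \prod_(i <- r) u i y).
Proof.
move=> Su; elim: r => [|i r IHr]; first by under eq_fun do rewrite big_nil;
  exact: smooth_on_cst.
by under eq_fun do rewrite big_cons; exact: (smooth_onM oV (Su i) IHr).
Qed.

Lemma deriv_sum i (L : Type) (r : seq L) (u : L -> M -> K^o) y : V y ->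
  (forall l, smooth_on V (u l)) ->
  deriv i (fun z => \sum_(l <- r) u l z) y = \sum_(l <- r) deriv i (u l) y.
Proof.
move=> Vy Su; elim: r => [|l r IHr].
  by under eq_fun do rewrite big_nil; rewrite deriv_cst big_nil.
under eq_fun do rewrite big_cons; rewrite big_cons -IHr.
exact: (derivD ach Vch i Vy (Su l) (smooth_on_sum r Su)).
Qed.

Lemma deriv_prod i m (u : nat -> M -> K^o) y : V y ->
  (forall l, smooth_on V (u l)) ->
  deriv i (fun z => \prod_(l < m) u l z) y =
  \sum_(j < m) \prod_(l < m) (if l == j :> nat then deriv i (u l) else u l) y.
Proof.
move=> Vy Su; elim: m => [|m IHm].
  by under eq_fun do rewrite big_ord0; rewrite deriv_cst big_ord0.
under eq_fun do rewrite big_ord_recr /=.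
have Sp : smooth_on V (fun z => \prod_(l < m) u l z) by exact:
  (smooth_on_prod _ (fun l : 'I_m => Su l)).
rewrite (derivM ach Vch i Vy Sp (Su m)) IHm.
rewrite big_ord_recr /=; congr (_ + _).
  rewrite mulr_suml; apply: eq_bigr => j _; rewrite big_ord_recr /=.
  by rewrite gtn_eqF.
rewrite big_ord_recr /= eqxx; congr (_ * _); apply: eq_bigr => l _.
by rewrite ltn_eqF.
Qed.

Lemma smooth_on_derivs_fun I (f : A) : smooth_on V (derivs I f).
Proof. by apply: (smooth_on_derivs oV ach Vch); exact: smooth_on_fun. Qed.

                                                                           
                                                                            
                 
Lemma form_deriv i m F : ((0 < m)%N -> forall I, adm I) ->
  form m F -> form m (fun s => deriv i (F s)).
Proof.
move=> all_adm [T [a [J [Sa aJ FE]]]].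
pose term t (s : seq A) y : K^o :=
  a t y * \prod_(j < m) derivs (J t j) (nth 0 s j) y.
have Sprod t (s : seq A) : smooth_on V
  (fun y => \prod_(j < m) derivs (J t j) (nth 0 s j) y).
  by apply: smooth_on_prod => j; exact: smooth_on_derivs_fun.
have Sterm t (s : seq A) : smooth_on V (term t s) by exact: smooth_onM.
apply: (@form_congr _ (fun s y =>
  \sum_t (deriv i (a t) y * \prod_(j < m) derivs (J t j) (nth 0 s j) y +
    \sum_(j < m) a t y * \prod_(l < m) derivs
      (if l == j :> nat then i :: J t l else J t l) (nth 0 s l) y))).
  move=> s sm y Vy.
  rewrite (deriv_congr oV ach Vch i Vy (FE s sm))
    (@deriv_sum _ _ _ (fun t => term t s))//.
  apply: eq_bigr => t _; rewrite (derivM ach Vch i Vy (Sa t) (Sprod t s));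
    congr (_ + _).
  rewrite (deriv_prod _ _ Vy (fun l =>
    smooth_on_derivs_fun (J t l) (nth 0 s l))).
  rewrite mulr_sumr; apply: eq_bigr => j _; congr (_ * _); apply: eq_bigr =>
    l _.
  by case: ifP.
apply: form_sum => t; apply: formD.
  by apply: form_monomial; [exact: smooth_on_deriv|exact: aJ].
apply: form_sum => j.
apply: (form_monomial (J := fun l => if l ==
  j :> nat then i :: J t l else J t l)) => //.
by move=> l lm; apply: all_adm; case: (m) lm.
Qed.

Lemma form_derivs I m F : ((0 < m)%N -> forall I, adm I) ->
  form m F -> form m (fun s => derivs I (F s)).
Proof. by move=> all_adm FF; elim: I => //= i I; exact: form_deriv. Qed.

Definition insertion (c e : seq A -> A) i l : seq A -> A := fun s =>
  c (take i s ++ e (take l (drop i s)) :: drop (i + l) s).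

                                                                            
                                        
Lemma form_insertion (c e : seq A -> A) i l r : ((0 < l)%N -> forall I, adm I)
  ->
  form (i + r.+1) (fun s => c s) -> form l (fun s => e s) ->
  form (i + (l + r)) (fun s => insertion c e i l s).
Proof.
move=> all_adm [T [a [J [Sa aJ cE]]]] eF.
pose block s : seq A := take l (drop i s).
pose F t s y : K^o := a t y * ((\prod_(j < i) derivs (J t j) (nth 0 s j) y) *
  (derivs (J t i) (e (block s)) y *
   \prod_(j < r) derivs (J t (i + j.+1)%N) (nth 0 s (i + (l + j))) y)).
have nth_block s j : (j < l)%N -> nth 0 (block s) j = nth 0 s (i + j).
  by move=> jl; rewrite nth_take// nth_drop.
apply: (@form_congr _ (fun s y => \sum_t F t s y)).
  move=> s sm y Vy; have i_s : (i <= size s)%N by rewrite sm leq_addr.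
  have take_i : size (take i s) = i by rewrite size_takel.
  rewrite /insertion cE//; last first.
    by rewrite size_cat /= take_i size_drop sm addnA addKn.
  apply: eq_bigr => t _; rewrite /F big_split_ord big_ord_recl /=.
  congr (_ * (_ * (_ * _))).
  - by apply: eq_bigr => j _; rewrite nth_cat take_i ltn_ord nth_take.
  - by rewrite addn0 nth_cat take_i ltnn subnn.
  - apply: eq_bigr => j _; rewrite nth_cat take_i ltnNge leq_addr /= addKn /=.
    by rewrite nth_drop addnA.
apply: form_sum => t.
have [T' [b [J' [Sb b_adm eE]]]] := form_derivs (J t i) all_adm eF.
                                                                             
                    
pose J'' u j := if (j < i)%N then J t j else
  if (j < i + l)%N then J' u (j - i)%N else J t (j - l).+1.
apply: (@form_congr _ (fun s y => \sum_u (a t y * b u y) *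
    \prod_(j < i + (l + r)) derivs (J'' u j) (nth 0 s j) y)).
  move=> s sm y Vy; rewrite /F eE//; last first.
    by rewrite size_takel// size_drop sm addKn leq_addr.
  rewrite mulr_suml !mulr_sumr; apply: eq_bigr => u _.
  rewrite -[LHS]mulrA; congr (_ * _).
  rewrite !big_split_ord /= -[X in _ = _ * X]mulrA [RHS]mulrCA;
    congr (_ * (_ * (_ * _))).
  - by apply: eq_bigr => j _; rewrite /J'' ltn_ord.
  - apply: eq_bigr => j _; rewrite nth_block// /J'' ltnNge leq_addr /=.
    by rewrite ltn_add2l ltn_ord addKn.
  - apply: eq_bigr => j _; rewrite /J'' ltnNge leq_addr /=
    ltn_add2l ltnNge leq_addr /=.
    by rewrite addnCA addKn addnS.
apply: form_sum => u; apply: (form_monomial (J := J'' u));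
  first exact: smooth_onM.
move=> j; rewrite /J''; case: ifP => [ji _|ij]; first by apply: aJ;
  rewrite ltn_addr.
case: ifP => [jil _|ilj jm]; first by apply: b_adm; lia.
by apply: aJ; lia.
Qed.

End OnV.
End LocalForms.

Section Polydifferential.
Variables (R : realType) (k : ground) (M : manifold R).
Local Notation K := (ground_field R k).
Local Notation A := (smooth_function k M).
Local Notation index := (seq 'I_(dim M)).
Local Notation C := (cochain k M).
Implicit Types (adm : pred index) (c e u w : C) (s t x z : seq A) (f g h : A).
Implicit Types (ch : chart R M (dim M)).

Lemma polydifferential_form adm c : polydifferential adm c ->
  forall m ch (y : M), atlas ch -> dom ch y -> exists V : set M,
    [/\ open V, V y, V `<=` dom ch & form ch adm V m (fun s => c s)].
Proof.
move=> Hc m ch y ach chy; have [V [N [a [J [[oV Vy Vch] Sa aJ cE]]]]] :=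
  Hc m ch y ach chy.
exists V; split=> //; exists 'I_N, a,
  (fun (i : 'I_N) j => if (insub j : option 'I_m) is Some j' then J i j' else
  [::]).
split=> // [i j jm|s sm y' Vy']; first by rewrite insubT.
rewrite (cE s sm y' Vy'); apply: eq_bigr => i _; congr (_ * _);
  apply: eq_bigr => j _.
by rewrite valK (partialsE oV ach Vch).
Qed.

Lemma form_polydifferential adm c :
  (forall m ch (y : M), atlas ch -> dom ch y -> exists V : set M,
    [/\ open V, V y, V `<=` dom ch & form ch adm V m (fun s => c s)]) ->
  polydifferential adm c.
Proof.
move=> Hc m ch y ach chy; have [V [oV Vy Vch [T [a [J [Sa aJ cE]]]]]] :=
  Hc m ch y ach chy.
exists V, #|T|, (fun i => a (enum_val i)), (fun i j => J (enum_val i) j).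
split=> // [i j|s sm y' Vy']; first exact: aJ.
rewrite (cE s sm y' Vy') (reindex (@enum_val T predT)) /=; last first.
  by exists enum_rank => ? _; [exact: enum_valK|exact: enum_rankK].
apply: eq_bigr => i _; congr (_ * _); apply: eq_bigr => j _.
by rewrite (partialsE oV ach Vch).
Qed.

                                                                                
                                                          
Lemma common_forms adm c e : polydifferential adm c -> polydifferential adm e ->
  forall N ch (y : M), atlas ch -> dom ch y -> exists V : set M,
    [/\ open V, V y, V `<=` dom ch & forall m, (m < N)%N ->
      form ch adm V m (fun s => c s) /\ form ch adm V m (fun s => e s)].
Proof.
move=> /polydifferential_form Hc /polydifferential_form He N ch y ach chy.
elim: N => [|N [V [oV Vy Vch VF]]].
  by exists (dom ch); split=> //; exact/chart_open_dom/atlas_chart.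
have [Vc [oVc Vcy Vcch VcF]] := Hc N ch y ach chy.
have [Ve [oVe Vey Vech VeF]] := He N ch y ach chy.
exists (V `&` (Vc `&` Ve)); split;
  [exact/openI/openI|by []|by move=> y' [/Vch]|].
move=> m; rewrite ltnS leq_eqVlt => /orP[/eqP ->|mN].
  by split; [apply: form_subset VcF|apply: form_subset VeF] => y' [_ []].
by have [Fc Fe] := VF m mN; split;
  [apply: form_subset Fc|apply: form_subset Fe] => y' [].
Qed.

Lemma polydifferential_linear adm c e (a : K) :
  polydifferential adm c -> polydifferential adm e ->
  polydifferential adm (a *: c + e : C).
Proof.
move=> Hc He; apply: form_polydifferential => m ch y ach chy.
have [V [oV Vy Vch /(_ m (ltnSn m))[Fc Fe]]] := common_forms Hc He m.+1 ach chy.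
exists V; split=> //.
exact: formD (formZ oV a Fc) Fe.
Qed.

Lemma polydifferential0 adm : polydifferential adm (0 : C).
Proof.
apply: form_polydifferential => m ch y ach chy; exists (dom ch); split=> //.
  exact/chart_open_dom/atlas_chart.
exact: form0.
Qed.

Lemma derivs_linear ch (V : set M) (I : index) (a : K) f g (y : M) :
  atlas ch -> open V -> V `<=` dom ch -> V y ->
  chart_derivs ch I (a *: f + g : A) y =
    a * chart_derivs ch I f y + chart_derivs ch I g y.
Proof.
move=> ach oV Vch; elim: I y => [//|i I IH] y Vy /=.
rewrite (deriv_congr oV ach Vch i Vy IH).
have Sf h : smooth_on V (chart_derivs ch I h) by exact: smooth_on_derivs_fun.
rewrite (derivD ach Vch i Vy (smooth_onM oV (smooth_on_cst oV a) (Sf f))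
  (Sf g)).
rewrite (derivM ach Vch i Vy (smooth_on_cst oV a) (Sf f)).
by rewrite deriv_cst mul0r add0r.
Qed.

Definition multilinear c := forall s t f g (a : K),
  c (s ++ (a *: f + g) :: t) = a *: c (s ++ f :: t) + c (s ++ g :: t).

Lemma polydifferential_multilinear adm c : polydifferential adm c ->
  multilinear c.
Proof.
move=> /polydifferential_form Hc s t f g a; apply: smooth_fun_ext => y.
have [ch ach chy] := atlas_cover y.
have [V [oV Vy Vch [T [b [J [Sb _ cE]]]]]] :=
  Hc (size s + (size t).+1)%N ch y ach chy.
have sE h : size (s ++ h :: t) = (size s + (size t).+1)%N by rewrite size_cat.
rewrite smooth_funD smooth_funZ !cE// mulr_sumr -big_split; apply: eq_bigr =>
  i _ /=.
have prodE h : \prod_(j < size s + (size t).+1) chart_derivs ch (J i j)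
  (nth 0 (s ++ h :: t) j) y =
    (\prod_(j < size s) chart_derivs ch (J i j) (nth 0 s j) y) *
    (chart_derivs ch (J i (size s)) h y *
     \prod_(j < size t) chart_derivs ch (J i (size s + j.+1)%N) (nth 0 t j) y).
  rewrite big_split_ord big_ord_recl /=; congr (_ * (_ * _)).
  - by apply: eq_bigr => j _; rewrite nth_cat ltn_ord.
  - by rewrite addn0 nth_cat ltnn subnn.
  - by apply: eq_bigr => j _; rewrite nth_cat ltnNge leq_addr /= addKn.
rewrite !prodE (derivs_linear _ _ _ _ ach oV Vch Vy).
by rewrite mulrDl !mulrDr; congr (_ + _); rewrite -mulrA 2!(mulrCA _ a).
Qed.

Lemma multilinear0 c s t : multilinear c -> c (s ++ 0 :: t) = 0.
Proof.
by move=> /(_ s t 0 0 (-1)); rewrite scaler0 addr0 scaleN1r addNr.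
Qed.

                                                                          
                                                                          
Lemma substitution_degree p q u w s t x : multilinear u ->
  has_degree p u -> has_degree q w -> u (s ++ w x :: t) != 0 ->
  (size x)%:Z = q + 1 /\ (size s + size t)%:Z = p.
Proof.
move=> lu hu hw; apply: contraNP => /not_andP H; apply/eqP.
have [xq|/hw ->] := eqVneq (size x)%:Z (q + 1); last exact: multilinear0.
apply: hu; case: H => [/(_ xq)//|H].
by apply/eqP => E; apply: H; move: E; rewrite size_cat /= addnS -addn1 PoszD =>
  /addIr.
Qed.

Lemma has_degree_linear p (a : K) c e :
  has_degree p c -> has_degree p e -> has_degree p (a *: c + e : C).
Proof.
move=> hc he s sp; have -> : (a *: c + e : C) s = a *: c s + e s by [].
by rewrite (hc s sp) (he s sp) scaler0 addr0.
Qed.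

Lemma degree_function_cons c f s : has_degree (- 1) c -> c (f :: s) = 0.
Proof. by move=> hc; apply: hc. Qed.

Lemma degree_function_cat c f s t : has_degree (- 1) c -> c (s ++ f :: t) = 0.
Proof. by move=> hc; apply: hc; rewrite size_cat addnS. Qed.

Section Gerstenhaber.

Lemma smooth_scalerAr (a : K) f g : a *: (f * g) = f * (a *: g).
Proof.
by apply: smooth_fun_ext => y;
  rewrite smooth_funZ !smooth_funM smooth_funZ mulrCA.
Qed.

Lemma insertion_degree p q u w i l s : (i + l <= size s)%N -> multilinear u ->
  has_degree p u -> has_degree q w -> insertion u w i l s != 0 ->
  l%:Z = q + 1 /\ (size s - l)%:Z = p.
Proof.
move=> ils lu hu hw /(substitution_degree lu hu hw).
rewrite !size_takel ?size_drop; [|lia|lia].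
by case=> -> <-; split=> //; congr Posz; lia.
Qed.

Lemma gerstenhaberE c e s : gerstenhaber c e s =
  \sum_(i < (size s).+1) \sum_(l < (size s - i).+1) (-1) ^+ (i * l.+1) *
    (insertion c e i l s - (-1) ^+ (l.+1 * (size s - l)) * insertion e c i l s).
Proof. by []. Qed.

Lemma gerstenhaber_linear u c e (a : K) : multilinear u ->
  gerstenhaber u (a *: c + e : C) = a *: gerstenhaber u c + gerstenhaber u e.
Proof.
move=> lu; apply/funext => s.
have -> : (a *: gerstenhaber u c + gerstenhaber u e : C) s =
  a *: gerstenhaber u c s + gerstenhaber u e s by [].
rewrite !gerstenhaberE scaler_sumr -big_split; apply: eq_bigr => i _ /=.
rewrite scaler_sumr -big_split; apply: eq_bigr => l _ /=.
rewrite smooth_scalerAr -mulrDr; congr (_ * _).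
have -> : insertion u (a *: c + e : C) i l s =
  a *: insertion u c i l s + insertion u e i l s.
  exact: lu.
have -> : insertion (a *: c + e : C) u i l s =
  a *: insertion c u i l s + insertion e u i l s.
  by [].
by rewrite mulrDr opprD addrACA scalerBr smooth_scalerAr.
Qed.

Lemma polydifferential_gerstenhaber c e :
  polydifferential predT c -> polydifferential predT e ->
  polydifferential predT (gerstenhaber c e).
Proof.
move=> Hc He; apply: form_polydifferential => m ch y ach chy.
have [V [oV Vy Vch VF]] := common_forms Hc He m.+2 ach chy.
exists V; split=> //.
have ins u w i l : (i <= m)%N -> (l <= m - i)%N ->
    (forall m', (m' < m.+2)%N -> form ch predT V m' (fun s => u s)) ->
    (forall m', (m' < m.+2)%N -> form ch predT V m' (fun s => w s)) ->
    form ch predT V m (fun s => insertion u w i l s).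
  move=> im lmi Fu Fw; have -> : m = (i + (l + (m - i - l)))%N by lia.
  by apply: form_insertion => //; [apply: Fu|apply: Fw]; lia.
apply: (@form_congr _ _ _ ch predT V m
  (fun s y => \sum_(i < m.+1) \sum_(l < (m - i).+1)
    ((-1) ^+ (i * l.+1) * insertion c e i l s y +
     (- (-1) ^+ (i * l.+1) * (-1) ^+ (l.+1 * (m - l))) * insertion e c i l s
       y))).
  move=> s <- y' _; rewrite gerstenhaberE smooth_fun_sum; apply: eq_bigr => i _.
  rewrite smooth_fun_sum; apply: eq_bigr => l _.
  by rewrite smooth_fun_sign smooth_funD smooth_funN smooth_fun_sign mulrBr
    !mulNr mulrA.
apply: form_sum => i; apply: form_sum => l.
have im : (i <= m)%N by rewrite -ltnS.
have lmi : (l <= m - i)%N by rewrite -ltnS.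
apply: formD; apply: formZ => //.
  by apply: (ins c e i l im lmi) => m' /VF[].
by apply: (ins e c i l im lmi) => m' /VF[].
Qed.

Lemma has_degree_gerstenhaber p q c e : multilinear c -> multilinear e ->
  has_degree p c -> has_degree q e -> has_degree (p + q) (gerstenhaber c e).
Proof.
move=> lc le hc he s sp; rewrite gerstenhaberE big1// => i _; rewrite big1// =>
  l _.
have ils : (i + l <= size s)%N by move: (ltn_ord i) (ltn_ord l); lia.
have [->|] := eqVneq (insertion c e i l s) 0; last first.
  by move=> /(insertion_degree ils lc hc he); lia.
have [->|] := eqVneq (insertion e c i l s) 0; last first.
  by move=> /(insertion_degree ils le he hc); lia.
by rewrite mulr0 subr0 mulr0.
Qed.

                                                                              
                                                                           
                                                           
Lemma gerstenhaberC p q c e : multilinear c -> multilinear e ->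
  has_degree p c -> has_degree q e -> p = - 1 \/ p = 1 -> q = - 1 \/ q = 1 ->
  gerstenhaber c e = gerstenhaber e c.
Proof.
move=> lc le hc he op oq; apply/funext => s; rewrite !gerstenhaberE.
apply: eq_bigr => i _; apply: eq_bigr => l _; congr (_ * _).
have ils : (i + l <= size s)%N by move: (ltn_ord i) (ltn_ord l); lia.
have sgn : insertion c e i l s != 0 \/ insertion e c i l s != 0 ->
    (-1) ^+ (l.+1 * (size s - l)) = -1 :> A.
  move=> H; have [el os] : ~~ odd l /\ odd (size s - l).
    by case: H => [/(insertion_degree ils lc hc he)|/(insertion_degree ils le he
      hc)]; lia.
  by rewrite -signr_odd oddM oddS el os.
have [c0|c0] := eqVneq (insertion c e i l s) 0; last first.
  by rewrite sgn ?mulN1r ?opprK; [rewrite addrC|left].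
have [e0|e0] := eqVneq (insertion e c i l s) 0; last first.
  by rewrite sgn ?mulN1r ?opprK; [rewrite addrC|right].
by rewrite c0 e0.
Qed.

                                                                              
                                                                              
Lemma gerstenhaber_functionr c e s : multilinear c -> has_degree (- 1) e ->
  gerstenhaber c e s =
  \sum_(i < (size s).+1) (-1) ^+ i * c (take i s ++ e [::] :: drop i s).
Proof.
move=> lc he; rewrite gerstenhaberE; apply: eq_bigr => i _.
rewrite big_ord_recl big1 ?addr0 => [|l _];
  rewrite /insertion (degree_function_cat _ _ _ he).
  by rewrite mulr0 subr0 muln1 take0 addn0.
rewrite he ?multilinear0 ?mulr0 ?subr0 ?mulr0//.
rewrite size_takel ?size_drop //; by move: (ltn_ord i) (ltn_ord l); rewrite /=
  /bump; lia.
Qed.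

Lemma gerstenhaber_functionl c e s : multilinear c -> has_degree (- 1) e ->
  gerstenhaber e c s =
  - (-1) ^+ size s * \sum_(i < (size s).+1) (-1) ^+ i * c
    (take i s ++ e [::] :: drop i s).
Proof.
move=> lc he; rewrite gerstenhaberE mulr_sumr; apply: eq_bigr => i _.
rewrite big_ord_recl big1 ?addr0 => [|l _];
  rewrite /insertion (degree_function_cat _ _ _ he).
  by rewrite sub0r muln1 mul1n subn0 take0 addn0 mulrN mulrCA mulNr.
rewrite he ?multilinear0 ?mulr0 ?subr0 ?mulr0//.
rewrite size_takel ?size_drop //; by move: (ltn_ord i) (ltn_ord l); rewrite /=
  /bump; lia.
Qed.

Lemma multiplication_comp : has_degree 1 (@multiplication R k M) /\
  polydifferential predT (@multiplication R k M).
Proof.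
split=> [s|]; first by case: s => [|f [|g [|h s]]].
apply: form_polydifferential => m ch y ach chy; exists (dom ch).
have oV := chart_open_dom (atlas_chart ach).
split=> //; have [->|m2] := eqVneq m 2%N.
  apply: (@form_congr _ _ _ ch predT (dom ch) 2 (fun s y => 1 *
      \prod_(j < 2) chart_derivs ch [::] (nth 0 s j) y)); last first.
    by apply: (@form_monomial _ _ _ ch predT (dom ch) 2 (fun=> 1) (fun=> [::]))
      => //; exact: smooth_on_cst.
  by move=> [|f [|g []]]// _ y' _; rewrite mul1r !big_ord_recl big_ord0 /=
    mulr1.
apply: (@form_congr _ _ _ ch predT (dom ch) m (fun _ _ => 0));
  last exact: form0.
by move=> s sm; move: m2; rewrite -sm; case: s {sm} => [|f [|g [|h s]]].
Qed.

Lemma gerstenhaber_pair (P h : C) g : has_degree 1 P -> multilinear P ->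
  has_degree (- 1) h ->
  gerstenhaber P h [:: g] = P [:: h [::]; g] - P [:: g; h [::]].
Proof.
move=> hP lP hh; rewrite gerstenhaber_functionr//=.
by rewrite !big_ord_recl big_ord0 /= expr0 mul1r addr0 mulN1r.
Qed.

End Gerstenhaber.

End Polydifferential.

Section Dpoly.
Variables (R : realType) (k : ground) (M : manifold R).
Local Notation C := (cochain k M).

                                                                               
                   
Lemma Dpoly_calculus : low_degree_calculus (Dpoly k M).
Proof.
have lin (c : C) : polydifferential predT c ->
  multilinear c by exact: polydifferential_multilinear.
have comp_brak p q (c e : C) : dg_comp p (c : Dpoly k M) ->
  dg_comp q (e : Dpoly k M) ->
    dg_comp (p + q) (dg_brak (c : Dpoly k M) e).
  move=> [hc Pc] [he Pe]; split; last exact: polydifferential_gerstenhaber.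
  by apply: has_degree_gerstenhaber => //; exact: lin.
have [m1 mP] := multiplication_comp k M.
split.
- by move=> p c a b [ha Pa] [hb Pb]; split;
  [exact: has_degree_linear|exact: polydifferential_linear].
- by move=> p; split; [move=> s _|exact: polydifferential0].
- by move=> p q c e a b [_ /lin le] _ _; exact: gerstenhaber_linear.
- by move=> p c a b _ _; apply: gerstenhaber_linear; exact: lin.
- move=> f [hf Pf]; apply/funext => s.
  have [[g ->]|s1] := pselect (exists g, s = [:: g]).
    rewrite [LHS](gerstenhaber_pair _ m1 (lin _ mP) hf) /= mulrC subrr.
    by [].
  have [h0 _] := comp_brak 1 (-1) _ _ (conj m1 mP) (conj hf Pf).
  apply: h0; rewrite subrr add0r; apply: contra_notN s1.
  by case: s => [|g [|? ?]]//= _; exists g.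
- by move=> P hP; exact: comp_brak 1 1 _ _ (conj m1 mP) hP.
- by move=> f P hf hP; exact: comp_brak hf hP.
- by move=> P Q hP hQ; exact: comp_brak hP hQ.
- move=> f P [hf /lin lf] [hP /lin lP].
  by apply: gerstenhaberC lP lf hP hf _ _; [right|left].
- move=> P Q [hP /lin lP] [hQ /lin lQ].
  by apply: gerstenhaberC lP lQ hP hQ _ _; [right|right].
- move=> f h P hf hh hP.
  have [hPh /lin lPh] := comp_brak _ _ _ _ hP hh.
  have [hPf /lin lPf] := comp_brak _ _ _ _ hP hf.
  have [dfh _] := comp_brak _ _ _ _ hf (comp_brak _ _ _ _ hP hh).
  have [dhf _] := comp_brak _ _ _ _ hh (comp_brak _ _ _ _ hP hf).
  case: hP hf hh => [hP /lin lP] [hf _] [hh _].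
  have E (a b : C) : multilinear (gerstenhaber P a) -> has_degree (-1) a ->
      has_degree (-1) b ->
      gerstenhaber b (gerstenhaber P a) [::] =
        P [:: b [::]; a [::]] - P [:: a [::]; b [::]].
    move=> lPa ha hb; rewrite (gerstenhaber_functionl _ lPa hb).
    rewrite big_ord_recl big_ord0 /= !expr0 mulN1r mul1r addr0.
    by rewrite gerstenhaber_pair// opprB.
  apply/funext => s; have -> : (- dg_brak h (dg_brak P f) : Dpoly k M) s =
    - (gerstenhaber h (gerstenhaber P f) s) by [].
  case: s => [|g s].
    by rewrite [LHS](E h f lPh hh hf) (E f h lPf hf hh) opprB.
  rewrite [LHS](dfh (g :: s)) //
    -[gerstenhaber _ _ _]/(dg_brak h (dg_brak P f) (g :: s)) (dhf (g :: s)) //.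
  exact/esym/oppr0.
Qed.

End Dpoly.

                                                   

Lemma half_double (F : numFieldType) (x : F) : 2^-1 * (x + x) = x.
Proof. by rewrite -mulr2n -(mulr_natl x) mulKf// pnatr_eq0. Qed.

Lemma mul_sum_sub (F : comPzRingType) (I : finType) (X Y : I -> F) (c x y : F) :
  c * ((\sum_i X i) * x - (\sum_i Y i) * y) = \sum_i c * (X i * x - Y i * y).
Proof. by rewrite !mulr_suml -sumrB mulr_sumr. Qed.

Lemma distribute_parts (F : comNzRingType) (a b d d' w dw dw' x x' : F) :
  a * ((d * w + b * dw) * x - (d' * w + b * dw') * x') =
  a * (d * w * x - d' * w * x') + a * b * (dw * x - dw' * x').
Proof. ring. Qed.

Lemma first_part_monomials (F : comNzRingType) (a d d' p q r t x x' : F) :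
  a * d * (p * q * x) + -1 * (a * d * (r * t * x)) +
  (a * d' * (r * t * x') + -1 * (a * d' * (p * q * x'))) =
  a * (d * (p * q - r * t) * x - d' * (p * q - r * t) * x').
Proof. ring. Qed.

                                                                             
                                                                      
                                                         
Lemma wedge_bracket_cancel (F : comNzRingType) (a b : F)
    (fi fj fk fl gi gj gk gl hi hj hk hl : F)
    (fik fil fjk fjl gik gil gjk gjl hik hil hjk hjl : F)
    (fki fli fkj flj gki gli gkj glj hki hli hkj hlj : F) :
  fki = fik -> fli = fil -> fkj = fjk -> flj = fjl ->
  gki = gik -> gli = gil -> gkj = gjk -> glj = gjl ->
  hki = hik -> hli = hil -> hkj = hjk -> hlj = hjl ->
  (a * b * ((fik * gl + fk * gil - (fil * gk + fl * gik)) * hj -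
            (fjk * gl + fk * gjl - (fjl * gk + fl * gjk)) * hi) +
   a * b * ((hik * fl + hk * fil - (hil * fk + hl * fik)) * gj -
            (hjk * fl + hk * fjl - (hjl * fk + hl * fjk)) * gi) +
   a * b * ((gik * hl + gk * hil - (gil * hk + gl * hik)) * fj -
            (gjk * hl + gk * hjl - (gjl * hk + gl * hjk)) * fi)) +
  (b * a * ((fki * gj + fi * gkj - (fkj * gi + fj * gki)) * hl -
            (fli * gj + fi * glj - (flj * gi + fj * gli)) * hk) +
   b * a * ((hki * fj + hi * fkj - (hkj * fi + hj * fki)) * gl -
            (hli * fj + hi * flj - (hlj * fi + hj * fli)) * gk) +
   b * a * ((gki * hj + gi * hkj - (gkj * hi + gj * hki)) * fl -
            (gli * hj + gi * hlj - (glj * hi + gj * hli)) * fk)) = 0.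
Proof. by do 12!move=> ->; ring. Qed.

Lemma sum_parts (F : zmodType) (I J : finType) (x y z x' y' z' : I -> J -> F) :
  \sum_i \sum_j (x i j + x' i j) + \sum_i \sum_j (y i j + y' i j) +
    \sum_i \sum_j (z i j + z' i j) =
  \sum_i \sum_j (x i j + y i j + z i j) + \sum_i \sum_j
    (x' i j + y' i j + z' i j).
Proof.
rewrite -!big_split; apply: eq_bigr => i _ /=; rewrite -!big_split.
by apply: eq_bigr => j _ /=; rewrite [in LHS](addrACA (x i j)) [LHS]addrACA.
Qed.

Lemma sum_cancel (F : zmodType) (I J : finType) (x y : I -> J -> F)
  (x' y' : J -> I -> F) :
  (forall i j, y i j + y' j i = 0) ->
  (\sum_i \sum_j x i j + \sum_i \sum_j y i j) +
  (\sum_j \sum_i x' j i + \sum_j \sum_i y' j i) =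
  \sum_i \sum_j x i j + \sum_j \sum_i x' j i.
Proof.
move=> yy'; rewrite addrACA [X in _ + (_ + X)]exchange_big
  -[X in _ + X]big_split /=.
rewrite [X in _ + X]big1 ?addr0// => i _.
by rewrite -big_split /= big1.
Qed.

Section Schouten.
Variables (R : realType) (k : ground) (M : manifold R).
Local Notation K := (ground_field R k).
Local Notation A := (smooth_function k M).
Local Notation index := (seq 'I_(dim M)).
Local Notation C := (cochain k M).
Implicit Types (c e u w P Q : C) (s : seq A) (f g h : A).

Definition graft u w (b : seq bool) s :=
  u (w (mask b s) :: mask (map negb b) s).

Lemma schoutenE c e s : schouten c e s =
  \sum_(b : (size s).-tuple bool) (-1) ^+ shuffle_inv b *
    (graft c e b s - (-1) ^+ ((count id b).+1 * (size s - count id b)) * graft e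
      c b s).
Proof. by []. Qed.

Lemma graft_degree p q u w s (b : (size s).-tuple bool) : multilinear u ->
  has_degree p u -> has_degree q w -> graft u w b s != 0 ->
  (count id b)%:Z = q + 1 /\ (size s - count id b)%:Z = p.
Proof.
move=> lu hu hw /(substitution_degree (s := [::]) lu hu hw).
rewrite !size_mask ?size_map ?size_tuple// add0n => -[<- <-]; split=> //;
  congr Posz.
rewrite -[X in (X - _)%N](size_tuple b) -(count_predC id b) addKn.
by rewrite count_map; apply: eq_count.
Qed.

Lemma schouten_linear u c e (a : K) : multilinear u ->
  schouten u (a *: c + e : C) = a *: schouten u c + schouten u e.
Proof.
move=> lu; apply/funext => s.
have -> : (a *: schouten u c + schouten u e : C) s =
  a *: schouten u c s + schouten u e s by [].
rewrite !schoutenE scaler_sumr -big_split; apply: eq_bigr => b _ /=.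
rewrite smooth_scalerAr -mulrDr; congr (_ * _).
have -> : graft u (a *: c + e : C) b s = a *: graft u c b s + graft u e b s.
  exact: (lu [::]).
have -> : graft (a *: c + e : C) u b s = a *: graft c u b s + graft e u b s.
  by [].
by rewrite mulrDr opprD addrACA scalerBr smooth_scalerAr.
Qed.

Lemma has_degree_schouten p q c e : multilinear c -> multilinear e ->
  has_degree p c -> has_degree q e -> has_degree (p + q) (schouten c e).
Proof.
move=> lc le hc he s sp; rewrite schoutenE big1// => b _.
have bs : (count id b <= size s)%N by rewrite -[leqRHS](size_tuple b)
  count_size.
have no (l : nat) (p' q' : int) : (l <= size s)%N -> p' + q' = p + q ->
    l%:Z = q' + 1 /\ (size s - l)%:Z = p' -> False by lia.
have [->|/(graft_degree lc hc he)/(no _ _ _ bs)] := eqVneq (graft c e b s) 0;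
  last by case.
have [->|/(graft_degree le he hc)/(no _ _ _ bs)] := eqVneq (graft e c b s) 0;
  last first.
  by case; rewrite addrC.
by rewrite mulr0 subr0 mulr0.
Qed.

Lemma schoutenC p q c e : multilinear c -> multilinear e ->
  has_degree p c -> has_degree q e -> p = - 1 \/ p = 1 -> q = - 1 \/ q = 1 ->
  schouten c e = schouten e c.
Proof.
move=> lc le hc he op oq; apply/funext => s; rewrite !schoutenE.
apply: eq_bigr => b _; congr (_ * _).
have sgn : graft c e b s != 0 \/ graft e c b s != 0 ->
    (-1) ^+ ((count id b).+1 * (size s - count id b)) = -1 :> A.
  have parity (l r : nat) (p' q' : int) : p' = - 1 \/ p' = 1 -> q' = - 1 \/ q' =
    1 ->
    l%:Z = q' + 1 /\ r%:Z = p' -> ~~ odd l /\ odd r by lia.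
  move=> H; have [el os] : ~~ odd (count id b) /\ odd (size s - count id b).
    by case: H => [/(graft_degree lc hc he)|/(graft_degree le he hc)];
      exact: parity.
  by rewrite -signr_odd oddM oddS el os.
have [c0|c0] := eqVneq (graft c e b s) 0; last first.
  by rewrite sgn ?mulN1r ?opprK; [rewrite addrC|left].
have [e0|e0] := eqVneq (graft e c b s) 0; last first.
  by rewrite sgn ?mulN1r ?opprK; [rewrite addrC|right].
by rewrite c0 e0.
Qed.

Lemma schouten_function c e s : multilinear c -> has_degree (- 1) e ->
  (forall b : (size s).-tuple bool, has id b -> graft c e b s = 0) /\
  (forall b : (size s).-tuple bool, graft e c b s = 0).
Proof.
move=> lc he; split=> b; last exact: degree_function_cons.
rewrite has_count => b0; rewrite /graft he ?(multilinear0 [::])//.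
by rewrite size_mask ?size_tuple//; lia.
Qed.

                                                                      
                                        
Lemma sum_no_mask s (F : (size s).-tuple bool -> A) :
  (forall b : (size s).-tuple bool, has id b -> F b = 0) ->
  \sum_b F b = F (nseq_tuple (size s) false).
Proof.
move=> F0; rewrite (bigD1 (nseq_tuple (size s) false))//= big1 ?addr0// => b bN.
apply: F0; apply: contraR bN => /hasPn b0; apply/eqP/val_inj => /=.
rewrite -[X in nseq X](size_tuple b); apply/all_pred1P/allP => x /b0.
by case: x.
Qed.

Lemma shuffle_inv_no_mask n : shuffle_inv (nseq_tuple n false) = 0.
Proof.
by rewrite /shuffle_inv big1// => j _; rewrite big1// => i _;
  rewrite !tnth_nseq andbF.
Qed.

Lemma graft_no_mask c e s : graft c e (nseq (size s) false) s = c (e [::] :: s).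
Proof. by rewrite /graft map_nseq mask_false mask_true. Qed.

Lemma schouten_functionr c e s : multilinear c -> has_degree (- 1) e ->
  schouten c e s = c (e [::] :: s).
Proof.
move=> lc he; have [ce0 ec0] := schouten_function s lc he.
rewrite schoutenE sum_no_mask => [|b hb]; last by rewrite ce0//
  ec0 mulr0 subr0 mulr0.
by rewrite shuffle_inv_no_mask ec0 mulr0 subr0 mul1r graft_no_mask.
Qed.

Lemma schouten_functionl c e s : multilinear c -> has_degree (- 1) e ->
  schouten e c s = - (-1) ^+ size s * c (e [::] :: s).
Proof.
move=> lc he; have [ce0 ec0] := schouten_function s lc he.
rewrite schoutenE sum_no_mask => [|b hb]; last by rewrite ce0//
  ec0 mulr0 subr0 mulr0.
rewrite shuffle_inv_no_mask ec0 sub0r mul1r graft_no_mask.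
by rewrite count_nseq mul0n mul1n subn0 mulNr.
Qed.

                                                                  
Lemma sum_tuple_cons n (F : n.+1.-tuple bool -> A) :
  \sum_b F b = \sum_(b : n.-tuple bool) F (cons_tuple true b) +
               \sum_(b : n.-tuple bool) F (cons_tuple false b).
Proof.
rewrite (reindex (fun x : bool * n.-tuple bool => cons_tuple x.1 x.2)) /=;
  last first.
  exists (fun b => (thead b, behead_tuple b)) => [[x b]|b] _ /=.
    by rewrite theadE; congr (_, _); apply/val_inj.
  by rewrite [b in RHS]tuple_eta; apply/val_inj.
rewrite -(pair_bigA _ (fun x b => F (cons_tuple x b))) /=.
by rewrite big_bool.
Qed.

Lemma sum_tuple0 (F : 0.-tuple bool -> A) : \sum_b F b = F [tuple].
Proof.
by rewrite (big_pred1 [tuple])// => b; apply/esym/eqP; exact: tuple0.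
Qed.

Lemma shuffle_inv3 (b : 3.-tuple bool) : shuffle_inv b =
  ((~~ nth false b 0 && nth false b 1) + (~~ nth false b 0 && nth false b 2) +
   (~~ nth false b 1 && nth false b 2))%N.
Proof.
rewrite /shuffle_inv; under eq_bigr do rewrite big_mkcond.
by rewrite !big_ord_recl !big_ord0 /= !(tnth_nth false) /= !addn0 !add0n addnA.
Qed.

                                                                             
                  
Lemma schouten3 P Q f g h : has_degree 1 P -> has_degree 1 Q ->
  schouten P Q [:: f; g; h] =
  (P [:: Q [:: f; g]; h] - P [:: Q [:: f; h]; g] + P [:: Q [:: g; h]; f]) +
  (Q [:: P [:: f; g]; h] - Q [:: P [:: f; h]; g] + Q [:: P [:: g; h]; f]).
Proof.
move=> hP hQ; rewrite schoutenE /=.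
have zero (c : C) s : has_degree 1 c -> size s != 2%N -> c s = 0.
  by move=> hc s2; apply: hc; apply: contra_neq s2 => -[].
rewrite !sum_tuple_cons !sum_tuple0 !shuffle_inv3 /graft /=.
rewrite !(zero P [:: _])// !(zero P [:: _, _, _ & _])// !(zero Q [:: _])//
  !(zero Q [:: _, _, _ & _])//.
have even n : ~~ odd n -> (-1) ^+ n = 1 :> A by rewrite -signr_odd =>
  /negbTE ->.
have odd_ n : odd n -> (-1) ^+ n = -1 :> A by rewrite -signr_odd => ->.
rewrite !mulr0 !subr0 !mulr0 !(odd_ (_ * _)%N)// (odd_ (0 + 0 + 1)%N)// !even//.
rewrite !mul1r !mulN1r !opprK !add0r !addr0 opprD.
by rewrite (addrACA (P _) (Q _) (- P _)) [LHS]addrACA.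
Qed.

Lemma alternating_schouten P Q : has_degree 1 P -> has_degree 1 Q ->
  multilinear P -> multilinear Q -> alternating P -> alternating Q ->
  alternating (schouten P Q).
Proof.
move=> hP hQ lP lQ aP aQ s f g t.
have hPQ := has_degree_schouten lP lQ hP hQ.
have lN (c : C) (u v : A) : multilinear c -> c [:: - u; v] = - c [:: u; v].
  move=> lc; have := lc [::] [:: v] u 0 (-1).
  by rewrite (multilinear0 [::] _ lc) !scaleN1r !addr0.
have [st|st] := eqVneq (size s + size t)%N 1%N; last first.
  rewrite !hPQ ?oppr0// size_cat /= !addnS; apply: contra_neq st => -[].
    by [].
  by [].
case: s st => [|x [|? ?]]//= st.
  case: t st => [|x []]// _; rewrite !schouten3//
    (aP [::] f g [::]) (aQ [::] f g [::]) /=.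
  rewrite !lN// !opprD !opprK.
  by congr (_ + _); exact: addrAC.
case: t st => // _; rewrite !schouten3//
  (aP [::] f g [::]) (aQ [::] f g [::]) /=.
rewrite !lN// !opprD !opprK.
by rewrite (addrC (- P _)) (addrC (- Q _)).
Qed.

Section Local.
Variable ch : chart R M (dim M).
Hypothesis ach : atlas ch.
Variable V : set M.
Hypotheses (oV : open V) (Vch : V `<=` dom ch).
Local Notation D := (chart_deriv ch).
Local Notation first_order := [pred I : index | size I == 1%N].
Local Notation form3 := (form ch first_order V 3).

Definition wedge i j (u w : M -> K^o) (y : M) : K :=
  D i u y * D j w y - D j u y * D i w y.

                                                                              
                                                                             
                                                                 
Lemma bivector_form P : alternating P ->
  form ch first_order V 2 (fun s => P s) ->
  exists (T : finType) (a : T -> M -> K^o) (i j : T -> 'I_(dim M)),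
    (forall t, smooth_on V (a t)) /\
    forall f g y, V y -> P [:: f; g] y = \sum_t a t y * wedge (i t) (j t) f g y.
Proof.
move=> aP [T [a [J [Sa aJ PE]]]].
have single t j : (j < 2)%N -> exists i, J t j = [:: i].
  by move=> /(aJ t); case: (J t j) => [|i []]// _; exists i.
have [i iE] := choice (fun t => single t 0%N isT).
have [j jE] := choice (fun t => single t 1%N isT).
exists T, (fun t y => 2^-1 * a t y), i, j; split=> [t|f g y Vy].
  by apply: smooth_onM => //; exact: smooth_on_cst.
have PE' (u v : A) : P [:: u; v] y = \sum_t a t y * (D (i t) u y * D (j t) v y).
  rewrite PE//; apply: eq_bigr => t _; rewrite !big_ord_recl big_ord0 /= mulr1.
  by rewrite iE jE.
have -> : P [:: f; g] y = 2^-1 * (P [:: f; g] y - P [:: g; f] y).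
  by rewrite (aP [::] g f [::]) smooth_funN opprK; exact/esym/half_double.
rewrite !PE' -sumrB mulr_sumr; apply: eq_bigr => t _.
by rewrite -mulrBr mulrA /wedge; congr (_ * (_ - _)); rewrite mulrC.
Qed.

Lemma smooth_wedge i j f g : smooth_on V (fun y => wedge i j f g y : K^o).
Proof.
have S l h : smooth_on V (D l h) by exact:
  (smooth_on_derivs_fun ach oV Vch [:: l]).
have -> : (fun y => wedge i j f g y : K^o) =
    (fun y => D i f y * D j g y + (-1) * (D j f y * D i g y)).
  by apply/funext => y; rewrite mulN1r.
apply: smooth_onD => //; first exact: smooth_onM.
by apply: smooth_onM => //; [exact: smooth_on_cst|exact: smooth_onM].
Qed.

Definition deriv_wedge r i j (u w : M -> K^o) (y : M) : K :=
  D r (D i u) y * D j w y + D i u y * D r (D j w) y -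
  (D r (D j u) y * D i w y + D j u y * D r (D i w) y).

Lemma deriv_wedgeE r i j f g y : V y ->
  D r (fun z => wedge i j f g z : K^o) y = deriv_wedge r i j f g y.
Proof.
move=> Vy.
have S l h : smooth_on V (D l h) by exact:
  (smooth_on_derivs_fun ach oV Vch [:: l]).
have -> : (fun y => wedge i j f g y : K^o) =
    (fun y => D i f y * D j g y + (-1) * (D j f y * D i g y)).
  by apply/funext => z; rewrite mulN1r.
rewrite (derivD ach Vch r Vy (smooth_onM oV (S i f) (S j g))
  (smooth_onM oV (smooth_on_cst oV (-1))
  (smooth_onM oV (S j f) (S i g)))).
rewrite (derivM ach Vch r Vy (S i f) (S j g)).
rewrite (derivM ach Vch r Vy (smooth_on_cst oV (-1))
  (smooth_onM oV (S j f) (S i g))).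
by rewrite (derivM ach Vch r Vy (S j f) (S i g)) deriv_cst mul0r add0r mulN1r.
Qed.

Section Composite.
Variables (P Q : C) (T T' : finType) (a : T -> M -> K^o) (b : T' -> M -> K^o).
Variables (i j : T -> 'I_(dim M)) (k' l : T' -> 'I_(dim M)).
Hypotheses (Sa : forall t, smooth_on V (a t))
  (Sb : forall t, smooth_on V (b t)).
Hypothesis PE : forall f g y, V y ->
  P [:: f; g] y = \sum_t a t y * wedge (i t) (j t) f g y.
Hypothesis QE : forall f g y, V y ->
  Q [:: f; g] y = \sum_t b t y * wedge (k' t) (l t) f g y.

Definition first_part t t' f g h (y : M) : K :=
  a t y * (D (i t) (b t') y * wedge (k' t') (l t') f g y * D (j t) h y -
           D (j t) (b t') y * wedge (k' t') (l t') f g y * D (i t) h y).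

Definition second_part t t' f g h (y : M) : K := a t y * b t' y *
  (deriv_wedge (i t) (k' t') (l t') f g y * D (j t) h y -
   deriv_wedge (j t) (k' t') (l t') f g y * D (i t) h y).

                                                                               
                                                                             
Lemma composite_local f g h y : V y -> P [:: Q [:: f; g]; h] y =
  \sum_t \sum_t' (first_part t t' f g h y + second_part t t' f g h y).
Proof.
move=> Vy; rewrite PE//; apply: eq_bigr => t _.
have DQ r : D r (Q [:: f; g]) y =
  \sum_t' (D r (b t') y * wedge (k' t') (l t') f g y +
    b t' y * deriv_wedge r (k' t') (l t') f g y).
  rewrite (deriv_congr oV ach Vch r Vy
    (w := fun z => \sum_t' b t' z * wedge (k' t') (l t') f g z));
    last exact: QE.
  rewrite (deriv_sum ach oV Vch r _ Vy
    (u := fun t' z => b t' z * wedge (k' t') (l t') f g z)).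
    apply: eq_bigr => t' _; rewrite
      (derivM ach Vch r Vy (Sb t') (smooth_wedge _ _ _ _)).
    by rewrite deriv_wedgeE.
  by move=> t'; apply: smooth_onM => //; exact: smooth_wedge.
have -> : wedge (i t) (j t) (Q [:: f; g]) h y =
  D (i t) (Q [:: f; g]) y * D (j t) h y - D (j t) (Q [:: f; g]) y * D (i t) h y
    by [].
rewrite (DQ (i t)) (DQ (j t)).
rewrite (@mul_sum_sub K T') ; apply: eq_bigr => t' _.
exact: distribute_parts.
Qed.

Lemma form_first_part t t' :
  form3 (fun s => first_part t t' (nth 0 s 0) (nth 0 s 1) (nth 0 s 2)).
Proof.
have mono (c : M -> K^o) r1 r2 r3 : smooth_on V c -> form3 (fun s y => c y *
    (D r1 (nth 0 s 0 : A) y * D r2 (nth 0 s 1 : A) y * D r3 (nth 0 s 2 : A) y)).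
  move=> Sc; apply: form_congr (form_monomial ch
    (J := fun n => nth [::] [:: [:: r1]; [:: r2]; [:: r3]] n) Sc _).
    by move=> s _ y _; rewrite !big_ord_recl big_ord0 /= mulr1 !mulrA.
  by case=> [|[|[|]]].
have Sab r : smooth_on V (fun y => a t y * D r (b t') y).
  by apply: smooth_onM => //; exact: smooth_on_deriv.
apply: form_congr (formD (formD (mono _ (k' t') (l t') (j t) (Sab (i t)))
    (formZ oV (-1) (mono _ (l t') (k' t') (j t) (Sab (i t)))))
  (formD (mono _ (l t') (k' t') (i t) (Sab (j t)))
    (formZ oV (-1) (mono _ (k' t') (l t') (i t) (Sab (j t)))))).
move=> s _ y _; exact: (@first_part_monomials K).
Qed.

Lemma composite_cyclic f g h y : multilinear P -> alternating Q -> V y ->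
  (P [:: Q [:: f; g]; h] - P [:: Q [:: f; h]; g] + P [:: Q [:: g; h]; f]) y =
  \sum_t \sum_t' (first_part t t' f g h y + first_part t t' h f g y + first_part
    t t' g h f y) +
  \sum_t \sum_t' (second_part t t' f g h y + second_part t t' h f g y +
    second_part t t' g h f y).
Proof.
move=> lP aQ Vy.
                                              
have -> : - P [:: Q [:: f; h]; g] = P [:: Q [:: h; f]; g].
  have := lP [::] [:: g] (Q [:: h; f]) 0 (-1).
  rewrite (multilinear0 [::] _ lP) !scaleN1r !addr0 /= => E.
  by rewrite (aQ [::] f h [::]) /= E opprK.
rewrite !smooth_funD !composite_local//; exact: sum_parts.
Qed.

End Composite.

Lemma form3_rot (F : seq A -> M -> K^o) : form3 F ->
  form3 (fun s => F (rot 1 s)).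
Proof.
move=> [T [a [J [Sa aJ FE]]]].
                                                                          
exists T, a, (fun t j => J t ((j + 2) %% 3)%N); split=> // [t j j3|s s3 y Vy].
  by apply: aJ; rewrite ltn_mod.
rewrite FE ?size_rot//; apply: eq_bigr => t _; congr (_ * _).
case: s s3 => [|f [|g [|h []]]]// _.
rewrite !big_ord_recl !big_ord0 /= /bump /=.
by rewrite !mulr1 mulrA mulrC.
Qed.

                                                                        
                                                                              
                                                
Lemma form_schouten P Q : has_degree 1 P -> has_degree 1 Q ->
  multilinear P -> multilinear Q -> alternating P -> alternating Q ->
  form ch first_order V 2 (fun s => P s) ->
    form ch first_order V 2 (fun s => Q s) ->
  form3 (fun s => schouten P Q s).
Proof.
move=> hP hQ lP lQ aP aQ FP FQ.
have [T [a [i [j [Sa PE]]]]] := bivector_form aP FP.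
have [T' [b [k' [l [Sb QE]]]]] := bivector_form aQ FQ.
pose cyc (fp : A -> A -> A -> M -> K) s : M -> K^o := fun y =>
  fp (nth 0 s 0) (nth 0 s 1) (nth 0 s 2) y + fp (nth 0 s 2) (nth 0 s 0)
    (nth 0 s 1) y +
  fp (nth 0 s 1) (nth 0 s 2) (nth 0 s 0) y.
have form_cyc (fp : A -> A -> A -> M -> K) :
    form3 (fun s y => fp (nth 0 s 0) (nth 0 s 1) (nth 0 s 2) y : K^o) ->
      form3 (cyc fp).
  move=> F1; have F2 := form3_rot F1; have F3 := form3_rot F2.
  apply: form_congr (formD (formD F1 F3) F2).
  by move=> [|f [|g [|h []]]].
apply: (@form_congr _ _ _ ch first_order V 3 (fun s y =>
    \sum_t \sum_t' cyc (first_part a b i j k' l t t') s y +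
    \sum_t' \sum_t cyc (first_part b a k' l i j t' t) s y)); last first.
  apply: formD; apply: form_sum => t; apply: form_sum => t'; apply: form_cyc.
    exact: form_first_part Sa Sb t t'.
  exact: form_first_part Sb Sa t t'.
move=> [|f [|g [|h []]]]// _ y Vy; rewrite schouten3// smooth_funD.
rewrite (composite_cyclic Sb PE QE f g h lP aQ Vy)
  (composite_cyclic Sa QE PE f g h lQ aP Vy).
apply/esym/sum_cancel => t t'; apply: wedge_bracket_cancel.
all: by apply: (deriv_comm oV ach Vch) => //; exact: smooth_on_fun.
Qed.

End Local.
End Schouten.

Section Tpoly.
Variables (R : realType) (k : ground) (M : manifold R).
Local Notation A := (smooth_function k M).
Local Notation C := (cochain k M).
Local Notation first_order := [pred I : seq 'I_(dim M) | size I == 1%N].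

Lemma alternating_linear (a : ground_field R k) (c e : C) :
  alternating c -> alternating e -> alternating (a *: c + e : C).
Proof.
move=> ac ae s f g t.
have E x : (a *: c + e : C) x = a *: c x + e x by [].
by rewrite !E ac ae scalerN opprD.
Qed.

                                                                        
                                                                      
Lemma function_schouten_comp (f P : C) :
  dg_comp (- 1) (f : Tpoly k M) -> dg_comp 1 (P : Tpoly k M) ->
  dg_comp 0 (schouten f P : Tpoly k M).
Proof.
move=> [hf _ Df] [hP aP DP]; have lP := polydifferential_multilinear DP.
have lf := polydifferential_multilinear Df.
have E s : schouten f P s = - (-1) ^+ size s * P (f [::] :: s) by exact:
  schouten_functionl.
split.
- exact: has_degree_schouten lf lP hf hP.
- move=> s u v t; rewrite !E !size_cat /= -!cat_cons aP.
  by rewrite !mulrN.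
- apply: form_polydifferential => m ch y ach chy.
  have [V [oV Vy Vch VF]] := common_forms Df DP m.+2 ach chy.
  exists V; split=> //.
  apply: (@form_congr _ _ _ ch first_order V m (fun s y =>
    (- (-1) ^+ m) * insertion P f 0 0 s y)).
    move=> s <- y' _; rewrite E !mulNr smooth_funN smooth_fun_sign.
    by rewrite /insertion addn0 !take0 drop0.
  apply: formZ => //.
  have FP := (VF m.+1 (ltnSn _)).2; have Ff := (VF 0%N isT).1.
  by apply: (@form_insertion _ _ _ _ ach _ _ oV Vch P f 0 0 m _ FP Ff).
Qed.

Lemma bivector_schouten_comp (P Q : C) :
  dg_comp 1 (P : Tpoly k M) -> dg_comp 1 (Q : Tpoly k M) ->
  dg_comp 2 (schouten P Q : Tpoly k M).
Proof.
move=> [hP aP DP] [hQ aQ DQ].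
have lP := polydifferential_multilinear DP.
have lQ := polydifferential_multilinear DQ.
have hPQ := has_degree_schouten lP lQ hP hQ.
split=> //; first exact: alternating_schouten.
apply: form_polydifferential => m ch y ach chy.
have [V [oV Vy Vch /(_ 2%N isT)[FP FQ]]] := common_forms DP DQ 3 ach chy.
exists V; split=> //; have [->|m3] := eqVneq m 3%N; first exact: form_schouten.
apply: (@form_congr _ _ _ ch first_order V m (fun _ _ => 0)); last exact: form0.
move=> s sm y' _; rewrite hPQ// sm; apply: contra_neq m3 => -[].
by [].
Qed.

Lemma Tpoly_calculus : low_degree_calculus (Tpoly k M).
Proof.
have lin p (c : C) : dg_comp p (c : Tpoly k M) -> multilinear c.
  by case=> _ _; exact: polydifferential_multilinear.
have deg p (c : C) : dg_comp p (c : Tpoly k M) -> has_degree p c by case.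
have zero p : dg_comp p (0 : Tpoly k M).
  split; [by []| |exact: polydifferential0].
  by move=> s f g t; rewrite [RHS]oppr0.
have E (P a b : C) : multilinear P -> multilinear (schouten P a) ->
  has_degree (-1) a ->
    has_degree (-1) b ->
    schouten b (schouten P a) [::] = - P [:: a [::]; b [::]].
  move=> lP lPa ha hb; rewrite (schouten_functionl _ lPa hb) expr0 mulN1r.
  by rewrite (schouten_functionr _ lP ha).
split.
- move=> p c a b [ha aa Da] [hb ab Db]; split; first exact: has_degree_linear.
    exact: alternating_linear.
  exact: polydifferential_linear.
- exact: zero.
- by move=> p q c e a b /lin le _ _; exact: schouten_linear.
- by move=> p c a b _ _; rewrite /= scaler0 addr0.
- by [].
- by move=> P _; exact: zero.
- exact: function_schouten_comp.
- exact: bivector_schouten_comp.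
- move=> f P hf hP.
  by apply: schoutenC (lin _ _ hP) (lin _ _ hf) (deg _ _ hP) (deg _ _ hf) _ _;
    [right|left].
- move=> P Q hP hQ.
  by apply: schoutenC (lin _ _ hP) (lin _ _ hQ) (deg _ _ hP) (deg _ _ hQ) _ _;
    right.
- move=> f h P hf hh hP.
  have brak0 (a : C) : dg_comp (-1) (a : Tpoly k M) ->
    dg_comp 0 (schouten P a : Tpoly k M).
    move=> ha; rewrite (schoutenC (lin _ _ hP) (lin _ _ ha) (deg _ _ hP)
      (deg _ _ ha)); [|by right|by left].
    exact: function_schouten_comp.
  have lPh := lin _ _ (brak0 _ hh); have lPf := lin _ _ (brak0 _ hf).
  have dfh := has_degree_schouten (lin _ _ hf) lPh (deg _ _ hf)
    (deg _ _ (brak0 _ hh)).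
  have dhf := has_degree_schouten (lin _ _ hh) lPf (deg _ _ hh)
    (deg _ _ (brak0 _ hf)).
  apply/funext => s; have -> : (- dg_brak h (dg_brak P f) : Tpoly k M) s =
    - (schouten h (schouten P f) s) by [].
  case: s => [|g s].
    rewrite [LHS](E P h f (lin _ _ hP) lPh (deg _ _ hh) (deg _ _ hf)).
    rewrite (E P f h (lin _ _ hP) lPf (deg _ _ hf) (deg _ _ hh)) opprK.
    by case: hP => _ aP _; rewrite (aP [::] (h [::]) (f [::]) [::]) opprK.
  rewrite [LHS](dfh (g :: s))// (dhf (g :: s))//.
  exact/esym/oppr0.
Qed.

End Tpoly.

                           

Unset Implicit Arguments.

Theorem theorem4p6 (R : realType) (k : ground) (M : manifold R)
    (g : dg_data (ground_field R k))
    (hg : [\/ g = Tpoly k M, g = Dpoly k M,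
              g = formal (Tpoly k M) | g = formal (Dpoly k M)])
    (to : (nat -> g) -> g -> Prop) (hto : admissible_convergence to)
    (pi : g) (hpi : maurer_cartan pi)
    (X : seq g -> g) (hX : Linf_derivation X)
    (hconv : all_series_converge to X pi)
    (hnij : strong_nijenhuis to X pi)
    (f h : g) (hf : dg_comp (- 1) f) (hh : dg_comp (- 1) h)
    (hdf : twisted_diff pi f = 0) (hdh : twisted_diff pi h = 0) (m l : nat) :
  let X1 a := twisted to X pi [:: a] in
  pi_bracket pi (iter m X1 f) (iter l X1 h) = 0.
Proof.
have calculus : low_degree_calculus g.
  case: hg => ->; [exact: Tpoly_calculus|exact: Dpoly_calculus| |].
    exact/formal_calculus/Tpoly_calculus.
  exact/formal_calculus/Dpoly_calculus.
exact: (pi_bracket_iter calculus hto hpi hX hconv hnij hf hh hdf hdh).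
Qed.
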